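(* Let $\alpha=(\alpha^{ij})$ be a Poisson structure on $\mathbb R^d$, let $f,g\in C^\infty(\mathbb R^d)$, and let $f*g=fg+\sum_{n\ge1}\frac{h^n}{n!}\sum_{\Gamma\in G_{n,2}}W_\Gamma B_\Gamma(f,g)$ be Kontsevich's star-product. Then $$f*g(x)=\exp\Big(\frac1hD\big(h\partial_{x'},h\partial_{x''},x\big)\Big)f(x')g(x'')\Big|_{x'=x''=x},$$ where $D(p_1,p_2,x)=\sum_{j=0}^\infty h^jD^j(p_1,p_2,x)$ and $$D^j(p_1,p_2,x)=\sum_{\Gamma\in B^j}\frac{W_\Gamma}{|\Gamma|!}\hat B_\Gamma(p_1,p_2,x),$$ $B^j$ being the set of connected Kontsevich graphs of type $(n,2)$, $n\ge1$, with $j$ loops.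
   Context: Kontsevich graphs. A Kontsevich graph $\Gamma$ of type $(n,2)$ ($n\ge1$) is a directed graph with aerial vertices $V_\Gamma^a=\{1,\dots,n\}$ and ground vertices $V_\Gamma^g=\{\bar1,\bar2\}$ in which each aerial vertex $k$ has exactly two ordered outgoing edges $e_k^1=(k,\gamma^1(k))$, $e_k^2=(k,\gamma^2(k))$, there are no other edges, $\gamma^i(k)\ne k$, and $\gamma^1(k)\neq\gamma^2(k)$. (Vertices are labelled and edges ordered; graphs are not taken up to isomorphism.) $G_{n,2}$ is the set of these; $|\Gamma|=n$. $\Gamma$ is connected if its restriction to the aerial vertices is connected (as an undirected graph). For connected $\Gamma$ let $e_\Gamma$ be the number of edges landing at ground vertices; the number of loops of $\Gamma$ is $n-e_\Gamma+1\ge0$. Operators. $$B_\Gamma(f_1,f_2)=\sum_{I:E_\Gamma\to\{1,\dots,d\}}\Big[\prod_{k\in V_\Gamma^a}\Big(\prod_{e\in E_\Gamma,\ e=( *,k)}\partial_{I(e)}\Big)\alpha^{I(e_k^1)I(e_k^2)}\Big]\prod_{i=1,2}\Big(\prod_{e\in E_\Gamma,\ e=( *,\bar i)}\partial_{I(e)}\Big)f_i,$$ and its symbol $\hat B_\Gamma$ (polynomial in $p_1,p_2$) is defined by $B_\Gamma(e^{p_1x},e^{p_2x})=\hat B_\Gamma(p_1,p_2,x)e^{(p_1+p_2)x}$. In $D(h\partial_{x'},h\partial_{x''},x)$ one substitutes $p_1=h\partial_{x'}$, $p_2=h\partial_{x''}$, the derivatives acting on $f(x')g(x'')$ only ($x$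 is treated as an independent variable); $\frac1hD(h\partial_{x'},h\partial_{x''},x)$ is read as a formal power series in $h$, in which the term of $\Gamma$ has order $h^{|\Gamma|}$. Weights. Let $\mathcal H$ be the complex upper half plane and $D^n=\{(z_1,\dots,z_n)\in\mathcal H^n:\exists i\ne j,\ z_i=z_j\}$. Put $z_{\bar1}=0$, $z_{\bar2}=1$, $\phi^h(p,q)=\arg\big(\frac{q-p}{q-\bar p}\big)$ and $\psi^i_{z_k}=\phi^h(z_k,z_{\gamma^i(k)})$. Then $$W_\Gamma=\frac1{(2\pi)^{2n}}\int_{\overline{\mathcal H^n\setminus D^n}}\bigwedge_{k=1}^n\big(d\psi^1_{z_k}\wedge d\psi^2_{z_k}\big),$$ where the bar denotes Kontsevich's compactification to a manifold with corners with open stratum $\mathcal H^n\setminus D^n$ (so this is the convergent integral over $\mathcal H^n\setminus D^n$). *)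

(* Defs.v *)
From HB Require Import structures.
From mathcomp Require Import all_boot all_order all_algebra.
From mathcomp Require Import complex.
From mathcomp Require Import -(notations) mpoly.
From mathcomp Require Import all_classical all_reals all_analysis.
Set Implicit Arguments. Unset Strict Implicit. Unset Printing Implicit Defensive.
Import Order.TTheory GRing.Theory Num.Theory.
Import numFieldNormedType.Exports.
Local Open Scope classical_set_scope.
Local Open Scope ring_scope.

Section cons_measure.
Context {R : realType} {d : measure_display} {T : measurableType d} {n : nat}.
Variable mu : {sigma_finite_measure set T -> \bar R}.
Variable nu : {sigma_finite_measure set (n.-tuple T) -> \bar R}.
Local Open Scope ereal_scope.

Definition tcons (p : T * n.-tuple T) : n.+1.-tuple T := [tuple of p.1 :: p.2].

Lemma measurable_tcons : measurable_fun setT tcons.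
Proof. exact: measurable_cons. Qed.

Definition cons_measure : set (n.+1.-tuple T) -> \bar R :=
  pushforward (mu \x nu) tcons.

Let cons_measure0 : cons_measure set0 = 0.
Proof. by rewrite /cons_measure /pushforward preimage_set0 measure0. Qed.

Let cons_measure_ge0 A : 0 <= cons_measure A.
Proof.
rewrite /cons_measure /pushforward.
by have := measure_ge0 (mu \x nu) (tcons @^-1` A).
Qed.

Let cons_measure_sigma_additive : semi_sigma_additive cons_measure.
Proof.
move=> F mF tF mUF.
have mpre (A : set (n.+1.-tuple T)) : measurable A -> measurable (tcons @^-1` A).
  by move=> mA; rewrite -[X in measurable X]setTI; exact: measurable_tcons.
rewrite /cons_measure /pushforward preimage_bigcup.
apply: measure_semi_sigma_additive.
- by move=> k; exact: mpre.
- apply/trivIsetP => /= i j _ _ ij; rewrite -preimage_setI.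
  by move/trivIsetP : tF => /(_ _ _ _ _ ij) ->//; rewrite preimage_set0.
- by rewrite -preimage_bigcup; exact: mpre.
Qed.

HB.instance Definition _ := isMeasure.Build _ _ _ cons_measure
  cons_measure0 cons_measure_ge0 cons_measure_sigma_additive.

Let cons_measure_sigma_finite : sigma_finite setT cons_measure.
Proof.
have /sigma_finiteP[F [UF ndF mF]] := sigma_finiteT mu.
have /sigma_finiteP[G [UG ndG mG]] := sigma_finiteT nu.
pose uncons (t : n.+1.-tuple T) : T * n.-tuple T :=
  (tnth t ord0, [tuple of behead t]).
have unconsK : cancel tcons uncons.
  by case=> x t; rewrite /uncons /tcons/=; congr pair; apply: val_inj.
have muncons : measurable_fun setT uncons.
  apply/measurable_fun_pairP; split; first exact: measurable_tnth.
  exact: measurable_behead.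
exists (fun k => uncons @^-1` (F k `*` G k)).
  apply/esym; rewrite -preimage_bigcup -subTset => t _ /=.
  have [i _ Fi] : (\bigcup_k F k) (uncons t).1 by rewrite -UF.
  have [j _ Gj] : (\bigcup_k G k) (uncons t).2 by rewrite -UG.
  exists (maxn i j) => //; split.
    by move: (uncons t).1 Fi; exact/subsetPset/ndF/leq_maxl.
  by move: (uncons t).2 Gj; exact/subsetPset/ndG/leq_maxr.
move=> k; have [mFk Fkoo] := mF k; have [mGk Gkoo] := mG k; split.
  by rewrite -[X in measurable X]setTI; apply: muncons => //; exact: measurableX.
rewrite /cons_measure /pushforward -comp_preimage.
rewrite (_ : uncons \o tcons = id); last exact/funext.
by rewrite preimage_id product_measure1E// lte_mul_pinfty// ge0_fin_numE.
Qed.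

HB.instance Definition _ := Measure_isSigmaFinite.Build _ _ _ cons_measure
  cons_measure_sigma_finite.

End cons_measure.

(* The n-fold product measure on n-tuples, characterized by power_measure_box:
   the library only has the binary product. *)
Fixpoint power_measure {R : realType} {d : measure_display}
    {T : measurableType d} (mu : {sigma_finite_measure set T -> \bar R})
    (n : nat) : {sigma_finite_measure set (n.-tuple T) -> \bar R} :=
  if n is n'.+1 then cons_measure mu (power_measure mu n')
  else dirac [tuple].

Lemma power_measure_box {R : realType} {d : measure_display}
    {T : measurableType d} (mu : {sigma_finite_measure set T -> \bar R})
    (n : nat) (A : 'I_n -> set T) : (forall i, measurable (A i)) ->
  power_measure mu n [set t | forall i, A i (tnth t i)] =
  (\prod_(i < n) mu (A i))%E.
Proof.
elim: n A => [|n IHn] A mA.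
  by rewrite big_ord0 /= diracE mem_set // => -[].
rewrite big_ord_recl -IHn; last by move=> i; exact: mA.
rewrite /= /cons_measure /pushforward.
rewrite -product_measure1E //; last first.
  rewrite (_ : [set _ | _] = \bigcap_(i in [set: 'I_n])
      ((fun t => tnth t i) @^-1` A (lift ord0 i))); last first.
    by apply/seteqP; split => t /= h i => [_|]; exact: h.
  apply: fin_bigcap_measurable => // i _.
  by rewrite -[X in measurable X]setTI; exact: measurable_tnth.
congr (_ _); apply/seteqP; split => -[x t] /= h.
  split=> [|i]; first exact: (h ord0).
  by have := h (lift ord0 i); rewrite tnthS.
by move=> i; case: (unliftP ord0 i) => [j|] ->; [rewrite tnthS|]; case: h.
Qed.

(* The edge e_k^i is the pair (k, i); inl k is the aerial vertex k and inr i a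
   ground vertex, so that a graph is its target function (k, i) |-> gamma^i(k).
   The first and second edges are numbered ord0 and ord_max. *)
Notation edge n := ('I_n * 'I_2)%type.
Notation vertex n := ('I_n + 'I_2)%type.

Section kontsevich_graphs.
Variable n : nat.

Definition is_kgraph (gamma : {ffun edge n -> vertex n}) : bool :=
  [forall k : 'I_n, [forall i : 'I_2, gamma (k, i) != inl k] &&
    (gamma (k, ord0) != gamma (k, ord_max))].

Record kgraph := KGraph {
  target :> {ffun edge n -> vertex n};
  _ : is_kgraph target }.

HB.instance Definition _ := [isSub for target].
HB.instance Definition _ := [Finite of kgraph by <:].

Definition aerial_adj (G : kgraph) : rel 'I_n :=
  [rel k l | [exists i : 'I_2, (G (k, i) == inl l) || (G (l, i) == inl k)]].

Definition kconnected (G : kgraph) : bool :=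
  [forall k, forall l, connect (aerial_adj G) k l].

Definition ground_edges (G : kgraph) : nat :=
  #|[pred e : edge n | [exists i : 'I_2, G e == inr i]]|.

Definition loops (G : kgraph) : int := n%:Z - (ground_edges G)%:Z + 1.

End kontsevich_graphs.

Definition connected_graphs (j : nat) : set {n : nat & kgraph n} :=
  [set G : {n : nat & kgraph n} |
    [/\ (0 < tag G)%N, kconnected (tagged G) & loops (tagged G) = j]].

Section weights.
Context {R : realType}.

Local Notation plane := (2.-tuple (measurableTypeR R)).
Local Notation config n := (n.-tuple plane).

Definition cpoint (p : plane) : R[i] := Complex (tnth p ord0) (tnth p ord_max).

Section config.
Variable n : nat.

Definition half_spaces : set (config n) :=
  [set z | forall k, 0 < complex.Im (cpoint (tnth z k))].

Definition diagonals : set (config n) :=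
  half_spaces `&` [set z | exists k l, k != l /\ tnth z k = tnth z l].

Definition config_measure : {sigma_finite_measure set (config n) -> \bar R} :=
  power_measure (power_measure lebesgue_measure 2) n.

Definition position (z : config n) (v : vertex n) : R[i] :=
  match v with inl k => cpoint (tnth z k) | inr i => (i : nat)%:R end.

(* Moves the real (c = 0) or imaginary (c = 1) part of z_k by t. *)
Definition translate (z : config n) (kc : 'I_n * 'I_2) (t : R) : config n :=
  [tuple [tuple tnth (tnth z l) c + t *+ ((l, c) == kc) | c < 2] | l < n].

End config.

Arguments half_spaces : clear implicits.
Arguments diagonals : clear implicits.
Arguments config_measure : clear implicits.

Definition is_arg (w : R[i]) (t : R) : Prop :=
  w != 0 /\ w = `|w| * Complex (cos t) (sin t).

(* The angle is only defined modulo 2 pi: the derivative at t = 0 of arg (w t)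
   is that of any local determination of the argument which is differentiable
   at 0. *)
Definition darg (w : R -> R[i]) : R :=
  get [set c : R | exists theta : R -> R,
    (\forall t \near (0 : R), is_arg (w t) (theta t)) /\
    is_derive (0 : R) (1 : R) theta c].

(* phi^h(p, q) is the argument of this number. *)
Definition hyp_ratio (p q : R[i]) : R[i] := (q - p) / (q - p^*).

(* The partial derivative of psi^i_{z_k}, e = (k, i), in the coordinate kc. *)
Definition dpsi n (G : kgraph n) (e : edge n) (kc : 'I_n * 'I_2)
    (z : config n) : R :=
  darg (fun t => let zt := translate z kc t in
    hyp_ratio (position zt (inl e.1)) (position zt (G e))).

(* Rows psi^1_{z_1}, psi^2_{z_1}, psi^1_{z_2}, ..., columns
   x_1, y_1, x_2, ...: the determinant is the coefficient of the wedge product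
   of the forms dpsi in dx_1 dy_1 ... dx_n dy_n. *)
Definition angle_jacobian n (G : kgraph n) (z : config n) :
    'M[R]_#|{: 'I_n * 'I_2}| :=
  \matrix_(r, c) dpsi G (enum_val r) (enum_val c) z.

Definition weight n (G : kgraph n) : R :=
  ((2 * pi) ^+ (2 * n))^-1 *
  \int[config_measure n]_(z in half_spaces n `\` diagonals n)
    \det (angle_jacobian G z).

End weights.

Section operators.
Context {R : realType} {d : nat}.
Implicit Types (f g : 'rV[R]_d -> R) (x p : 'rV[R]_d).

Definition pderiv f (i : 'I_d) : 'rV[R]_d -> R := 'D_(delta_mx 0 i) f.

Definition pderivs f (s : seq 'I_d) : 'rV[R]_d -> R :=
  foldr (fun i h => pderiv h i) f s.

Definition smooth f : Prop := forall s : seq 'I_d,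
  continuous (pderivs f s) /\
  forall i x, derivable (pderivs f s) x (delta_mx 0 i).

Record is_poisson (alpha : 'I_d -> 'I_d -> 'rV[R]_d -> R) : Prop := IsPoisson {
  poisson_smooth : forall i j, smooth (alpha i j);
  poisson_anti : forall i j x, alpha i j x = - alpha j i x;
  poisson_jacobi : forall i j k x,
    \sum_l (alpha i l x * pderiv (alpha j k) l x +
            alpha j l x * pderiv (alpha k i) l x +
            alpha k l x * pderiv (alpha i j) l x) = 0 }.

Variable alpha : 'I_d -> 'I_d -> 'rV[R]_d -> R.

Definition incoming n (G : kgraph n) (I : {ffun edge n -> 'I_d})
    (v : vertex n) : seq 'I_d :=
  [seq I e | e <- enum {: edge n} & G e == v].

Definition kop n (G : kgraph n) f1 f2 x : R :=
  \sum_(I : {ffun edge n -> 'I_d})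
    (\prod_(k < n) pderivs (alpha (I (k, ord0)) (I (k, ord_max)))
                           (incoming G I (inl k)) x) *
    pderivs f1 (incoming G I (inr ord0)) x *
    pderivs f2 (incoming G I (inr ord_max)) x.

Definition dotv p x : R := \sum_i p 0 i * x 0 i.

Definition exp_fun p x : R := expR (dotv p x).

(* The symbol at x is the polynomial in the d + d variables (p_1, p_2) with the
   defining property; it is unique, as R is infinite. *)
Definition is_symbol n (G : kgraph n) x (P : mpoly (d + d) R) : Prop :=
  forall p1 p2, kop G (exp_fun p1) (exp_fun p2) x =
                meval (row_mx p1 p2 0) P * exp_fun (p1 + p2) x.

Definition symbol n (G : kgraph n) x : mpoly (d + d) R :=
  xget 0 [set P | is_symbol G x P].

(* The coefficient of h^m in f * g. *)
Definition star_product f g x (m : nat) : R :=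
  if m == 0%N then f x * g x
  else (m`!%:R)^-1 * \sum_(G : kgraph m) weight G * kop G f g x.

(* Coefficient of the monomial q of the formal power series D^j(p_1, p_2, x);
   only finitely many graphs with j loops contribute to it. *)
Definition Dloop x (j : nat) (q : multinom (d + d)) : R :=
  \sum_(G \in connected_graphs j)
    weight (tagged G) / (tag G)`!%:R * mcoeff q (symbol (tagged G) x).

End operators.

Section formal_series.

Definition series_mul {A : pzRingType} (S T : nat -> A) (m : nat) : A :=
  \sum_(i < m.+1) S i * T (m - i)%N.

Definition series_pow {A : pzRingType} (S : nat -> A) (k : nat) : nat -> A :=
  iter k (series_mul S) (fun m => (m == 0%N)%:R).

(* For S 0 = 0: the powers S^k with k > m do not contribute to h^m. *)
Definition series_exp {R : unitRingType} {A : lalgType R} (S : nat -> A)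
    (m : nat) : A :=
  \sum_(k < m.+1) (k`!%:R : R)^-1 *: series_pow S k m.

(* Division by h of a series with zero constant term. *)
Definition divh {A : Type} (S : nat -> A) (m : nat) : A := S m.+1.

Context {R : realType} {k : nat}.

(* Substitution p := h p in sum_j h^j D_j(p), where D_j is a formal power
   series in p given by its coefficients: the monomial q of D_j goes to
   h^(j + mdeg q). *)
Definition scale_vars (D : nat -> multinom k -> R) (m : nat) : mpoly k R :=
  \sum_(q : bmultinom k m.+1) D (m - mdeg q)%N q *: mpolyX R q.

(* The differential operator P(d/dz_1, ..., d/dz_k). *)
Definition diffop (P : mpoly k R) (F : 'rV[R]_k -> R) (z : 'rV[R]_k) : R :=
  \sum_(q <- msupp P)
    mcoeff q P * pderivs F (flatten [seq nseq (q i) i | i <- enum 'I_k]) z.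

End formal_series.

Definition tensor {R : realType} {d : nat} (f g : 'rV[R]_d -> R)
    (z : 'rV[R]_(d + d)) : R := f (lsubmx z) * g (rsubmx z).

(* Main.v *)
(* Let w(G) be the weight of G times its symbol.  The heart of the matter is that
   w is multiplicative on disjoint unions: for symbols this is a rearrangement
   of sums and products, for weights the matrix of the forms d psi is block
   diagonal, so that Fubini's theorem applies up to the null set of
   configurations where vertices of the two parts collide.  Cutting a graph
   along the component of a marked vertex then shows that the generating series
   A of w(G) / |G|! over all graphs and the series C over nonempty connected ones
   satisfy h A' = (h C') A; as A(0) = 1, A = exp C.  Finally a connected graph
   with n vertices and e ground edges has n - e + 1 >= 0 loops, its symbol is
   homogeneous of degree e, and so it contributes to h^n in the exponent. *)

Require Import Defs.
From HB Require Import structures.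
From mathcomp Require Import all_boot all_order all_algebra.
From mathcomp Require Import perm complex.
From mathcomp Require Import -(notations) ssrcomplements mpoly.
From mathcomp Require Import all_classical all_reals all_analysis.
From mathcomp Require Import measurable_realfun.
From mathcomp Require Import zify ring lra.
Set Implicit Arguments.
Unset Strict Implicit.
Unset Printing Implicit Defensive.
Import Order.TTheory GRing.Theory Num.Theory.
Import numFieldNormedType.Exports.
Local Open Scope ring_scope.

(** * Gluing of graphs and connected components *)

(** Graphs are labelled, so no automorphism groups enter, and marking a vertex avoids set
    partitions: removing only the marked component gives a linear recursion, and characteristic 0
    cancels the factor [n] that counts the marks. Three objects of the statement rest on choice or
    default values. [symbol] is replaced by the explicit polynomial [psym]. The angle derivative
    [darg] is replaced by the rational expression [dhyp_angle], which makes sense on every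
    configuration; this gives measurability and shows that an angle does not react to vertices of
    the other part. Real-valued integrals are 0 when infinite or undefined, and this convention is
    itself compatible with products. The labels of the two parts interleave arbitrarily, so lists of
    derivatives agree only up to permutation, which the symmetry of second derivatives absorbs;
    determinants are compared after the same permutation of rows and columns, which leaves the sign
    unchanged. *)

Definition vmap a b (h : 'I_a -> 'I_b) (v : vertex a) : vertex b :=
  match v with inl k => inl (h k) | inr i => inr i end.

Lemma vmap_inj a b (h : 'I_a -> 'I_b) : injective h -> injective (vmap h).
Proof. by move=> hi [k|i] [l|j] //= [] => [/hi ->|->]. Qed.

(** The parts are embedded by maps [s] and [t] rather than as initial and final segments, because a
    component can be any subset of the labels. The ground vertices are common to both parts. *)
Definition is_gluing n a b (s : 'I_a -> 'I_n) (t : 'I_b -> 'I_n)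
    (G : kgraph n) (G1 : kgraph a) (G2 : kgraph b) :=
  (forall k i, G (s k, i) = vmap s (G1 (k, i))) /\
  (forall k i, G (t k, i) = vmap t (G2 (k, i))).

Lemma is_kgraphP n (G : {ffun edge n -> vertex n}) :
  reflect (forall k, (forall i, G (k, i) <> inl k) /\ G (k, ord0) <> G (k,
    ord_max))
    (is_kgraph G).
Proof.
apply: (iffP forallP) => H k.
  have /andP[/forallP h1 /eqP h2] := H k.
  by split => // i; exact/eqP.
have [h1 h2] := H k; apply/andP; split; last exact/eqP.
by apply/forallP => i; exact/eqP.
Qed.

Lemma kgraphP n (G : kgraph n) k :
  (forall i, G (k, i) <> inl k) /\ G (k, ord0) <> G (k, ord_max).
Proof. by case: G => G /= /is_kgraphP; exact. Qed.

Lemma kgraph_eq n (G H : kgraph n) : G =1 H -> G = H.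
Proof. by move=> GH; apply: val_inj => /=; exact/ffunP. Qed.

Record vertex_split n a b (s : 'I_a -> 'I_n) (t : 'I_b -> 'I_n) : Prop :=
  VertexSplit {
    split_injl : injective s;
    split_injr : injective t;
    split_disj : forall k l, s k != t l;
    split_cover : forall m, (exists k, m = s k) \/ (exists k, m = t k) }.

Section gluing.
Variables (n a b : nat) (s : 'I_a -> 'I_n) (t : 'I_b -> 'I_n).
Hypothesis st : vertex_split s t.
Let s_inj := split_injl st.
Let t_inj := split_injr st.
Let st_disj := split_disj st.
Let st_cover := split_cover st.

(** The default [inr ord0] is never reached, since [s] and [t] together cover all vertices. *)
Definition glue_target (G1 : kgraph a) (G2 : kgraph b) : {ffun edge n ->
  vertex n} :=
  [ffun e => if [pick k | s k == e.1] is Some k then vmap s (G1 (k, e.2)) else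
             if [pick k | t k == e.1] is Some k then vmap t (G2 (k, e.2)) else
             inr ord0].

Lemma glue_targetl G1 G2 k i : glue_target G1 G2 (s k, i) = vmap s (G1 (k, i)).
Proof.
rewrite ffunE /=; case: pickP => [k' /eqP/s_inj -> //|/(_ k)]; by rewrite eqxx.
Qed.

Lemma glue_targetr G1 G2 k i : glue_target G1 G2 (t k, i) = vmap t (G2 (k, i)).
Proof.
rewrite ffunE /=; case: pickP => [k'|_];
  first by rewrite (negbTE (st_disj _ _)).
by case: pickP => [k' /eqP/t_inj -> //|/(_ k)]; rewrite eqxx.
Qed.

Lemma is_kgraph_glue G1 G2 : is_kgraph (glue_target G1 G2).
Proof.
apply/is_kgraphP => k; case: (st_cover k) => -[l ->].
  rewrite !glue_targetl; split; last by move/(vmap_inj s_inj);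
    exact: (kgraphP _ _).2.
  move=> i; rewrite glue_targetl.
  by move/(vmap_inj s_inj (x2 := inl l)); exact: (kgraphP _ _).1.
rewrite !glue_targetr; split; last by move/(vmap_inj t_inj);
  exact: (kgraphP _ _).2.
move=> i; rewrite glue_targetr.
by move/(vmap_inj t_inj (x2 := inl l)); exact: (kgraphP _ _).1.
Qed.

Definition glue G1 G2 := KGraph (is_kgraph_glue G1 G2).

Lemma glueP G1 G2 : is_gluing s t (glue G1 G2) G1 G2.
Proof. by split => k i /=; rewrite (glue_targetl, glue_targetr). Qed.

Lemma glue_inj : injective (fun G12 => glue G12.1 G12.2).
Proof.
move=> [G1 G2] [H1 H2] /= GH.
have [g1 g2] := glueP G1 G2; have [h1 h2] := glueP H1 H2.
rewrite GH in g1 g2; congr pair; apply: kgraph_eq => -[k i].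
  by apply: (vmap_inj s_inj); rewrite -g1 -h1.
by apply: (vmap_inj t_inj); rewrite -g2 -h2.
Qed.

Lemma is_gluing_glue G G1 G2 : is_gluing s t G G1 G2 -> G = glue G1 G2.
Proof.
move=> [g1 g2]; have [h1 h2] := glueP G1 G2.
apply: kgraph_eq => -[k i]; case: (st_cover k) => -[l ->].
  by rewrite g1 h1.
by rewrite g2 h2.
Qed.

End gluing.

Lemma aerial_adj_sym n (G : kgraph n)  : ssrbool.symmetric (aerial_adj G).
Proof. by move=> k l /=; apply: eq_existsb => i; rewrite orbC. Qed.

Lemma connect_aerial_sym n (G : kgraph n) : connect_sym (aerial_adj G).
Proof. exact/sym_connect_sym/aerial_adj_sym. Qed.

Section component.
Variables (n : nat) (S : {set 'I_n}).

Definition sub_in (T : {set 'I_n}) : 'I_#|T| -> 'I_n := @enum_val _ (mem T).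

Lemma sub_in_inj T : injective (@sub_in T).
Proof. exact: enum_val_inj. Qed.

Lemma sub_inP T k : @sub_in T k \in T.
Proof. exact: enum_valP. Qed.

Lemma sub_in_surj (T : {set 'I_n}) (m : 'I_n) : m \in T ->
  exists k, m = @sub_in T k.
Proof. by move=> mT; exists (enum_rank_in mT m);
  rewrite /sub_in enum_rankK_in. Qed.

Lemma sub_in_disj k l : @sub_in S k != @sub_in (~: S) l.
Proof.
apply/eqP => e; have := sub_inP l; rewrite -e inE.
by rewrite sub_inP.
Qed.

Lemma sub_in_cover m :
  (exists k, m = @sub_in S k) \/ (exists k, m = @sub_in (~: S) k).
Proof.
by have [mS|mS] := boolP (m \in S); [left|right]; apply: sub_in_surj;
  rewrite // inE.
Qed.

Lemma sub_in_split : vertex_split (@sub_in S) (@sub_in (~: S)).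
Proof.
split; [exact: sub_in_inj|exact: sub_in_inj|exact: sub_in_disj|].
exact: sub_in_cover.
Qed.

Variable G : kgraph n.

Definition adj_closed (T : {set 'I_n}) :=
  forall k i l, k \in T -> G (k, i) = inl l -> l \in T.

Lemma restrict_subproof (T : {set 'I_n}) : adj_closed T ->
  exists H : kgraph #|T|, forall k i, G (@sub_in T k,
    i) = vmap (@sub_in T) (H (k, i)).
Proof.
move=> Tc.
have key (e : edge #|T|) : exists v, G (@sub_in T e.1,
  e.2) == vmap (@sub_in T) v.
  case E : (G _) => [l|i]; last by exists (inr i).
  have := Tc _ _ _ (sub_inP _) E.
  by move=> /sub_in_surj[m ->]; exists (inl m).
pose H : {ffun edge #|T| -> vertex #|T|} := [ffun e => xchoose (key e)].
have HE k i : G (@sub_in T k, i) = vmap (@sub_in T) (H (k, i)).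
  by rewrite /H ffunE; have /eqP := xchooseP (key (k, i)).
have kH : is_kgraph H.
  apply/is_kgraphP => k; have [g1 g2] := kgraphP G (@sub_in T k); split.
    by move=> i Hi; apply: (g1 i); rewrite HE Hi.
  by move=> H01; apply: g2; rewrite !HE H01.
by exists (KGraph kH).
Qed.

Lemma is_gluing_restrict : adj_closed S -> adj_closed (~: S) ->
  exists G1 G2, is_gluing (@sub_in S) (@sub_in (~: S)) G G1 G2.
Proof.
move=> /restrict_subproof[G1 g1] /restrict_subproof[G2 g2].
by exists G1, G2.
Qed.

Lemma gluing_adjl G1 G2 : is_gluing (@sub_in S) (@sub_in (~: S)) G G1 G2 ->
  forall k l, aerial_adj G (@sub_in S k) (@sub_in S l) = aerial_adj G1 k l.
Proof.
move=> [g1 g2] k l /=; apply: eq_existsb => i; rewrite !g1.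
by congr (_ || _); apply/eqP/eqP => [|->//];
  exact: (vmap_inj (@sub_in_inj S) (x2 := inl _)).
Qed.

Lemma gluing_adjlr G1 G2 : is_gluing (@sub_in S) (@sub_in (~: S)) G G1 G2 ->
  forall k l, aerial_adj G k l -> k \in S -> l \in S.
Proof.
move=> [g1 g2] k l /= /existsP[i kl] /sub_in_surj[k' ek];
  apply/negPn/negP => lS.
have lS' : l \in ~: S by rewrite inE.
have [l' el] := sub_in_surj lS'.
move: kl; rewrite ek el g1 g2.
case: (G1 _) => [m|m]; case: (G2 _) => [m'|m'] //=; rewrite ?orbF ?orFb.
- by case/orP => /eqP[] => /eqP;
    rewrite ?(negbTE (sub_in_disj _ _))// eq_sym (negbTE (sub_in_disj _ _)).
- by move=> /eqP[] => /eqP; rewrite (negbTE (sub_in_disj _ _)).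
- by move=> /eqP[] => /eqP; rewrite eq_sym (negbTE (sub_in_disj _ _)).
Qed.

Lemma gluing_connect G1 G2 : is_gluing (@sub_in S) (@sub_in (~: S)) G G1 G2 ->
  forall k l, connect (aerial_adj G) (@sub_in S k) (@sub_in S l) =
              connect (aerial_adj G1) k l.
Proof.
move=> gl k l; apply/idP/idP => /connectP[p].
  elim: p k => [|m p IH] k /= pp el; first by rewrite (sub_in_inj el) connect0.
  move/andP: pp => [km pp].
  have /sub_in_surj[m' em] := gluing_adjlr gl km (sub_inP k).
  rewrite em in pp el km; rewrite (gluing_adjl gl) in km.
  exact: connect_trans (connect1 km) (IH _ pp el).
elim: p k => [|m p IH] k /= pp el; first by rewrite el connect0.
move/andP: pp => [km pp].
rewrite -(gluing_adjl gl) in km.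
exact: connect_trans (connect1 km) (IH _ pp el).
Qed.

Lemma gluing_connect_in G1 G2 : is_gluing (@sub_in S) (@sub_in (~: S)) G G1 G2
  ->
  forall k l, connect (aerial_adj G) k l -> k \in S -> l \in S.
Proof.
move=> gl k l /connectP[p]; elim: p k => [|m p IH] k /= pp el kS;
  first by rewrite el.
move/andP: pp => [km pp]; apply: (IH m) => //.
exact: (gluing_adjlr gl km kS).
Qed.

End component.

Definition component n (G : kgraph n) (v : 'I_n) : {set 'I_n} :=
  [set w | connect (aerial_adj G) v w].

(** An edge between [S] and its complement, in either direction, would enlarge the component; so
    both sets are closed under outgoing edges and the graph splits. Conversely, no edge of a gluing
    leaves [S], and connectedness of the first factor makes [S] the whole component. *)
Lemma component_glue n (S : {set 'I_n}) (v : 'I_n) : v \in S ->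
  [set G | component G v == S] =
  [set glue (sub_in_split S) G12.1 G12.2 | G12 in [set G12 | kconnected G12.1]].
Proof.
move=> vS; apply/setP => G; rewrite inE; apply/eqP/imsetP.
  move=> cS.
  have SE w : (w \in S) = connect (aerial_adj G) v w by rewrite -cS inE.
  have [||G1 [G2 gl]] := @is_gluing_restrict n S G.
  - move=> k i l; rewrite !SE => vk kl; apply: (connect_trans vk);
      apply: connect1.
    by apply/existsP; exists i; rewrite kl eqxx.
  - move=> k i l; rewrite !inE !SE => vk kl; apply: contra vk => vl.
    apply: (connect_trans vl); apply: connect1.
    by apply/existsP; exists i; rewrite kl eqxx orbT.
  exists (G1, G2); last exact: is_gluing_glue gl.
  rewrite inE /=; apply/forallP => k; apply/forallP => l.
  rewrite -(gluing_connect gl); apply: (@connect_trans _ _ v).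
    by rewrite connect_aerial_sym -SE sub_inP.
  by rewrite -SE sub_inP.
move=> [[G1 G2]]; rewrite inE /= => /forallP cG1 ->.
have gl := glueP (sub_in_split S) G1 G2.
apply/setP => w; rewrite inE; apply/idP/idP => [vw|wS].
  exact: gluing_connect_in gl _ _ vw vS.
have [k ->] := sub_in_surj vS; have [l ->] := sub_in_surj wS.
by rewrite (gluing_connect gl); have /forallP := cG1 k; exact.
Qed.

(* The pairs (G, v) are counted according to the component of v in G. *)
Lemma sum_component (A : comPzRingType) (w : forall n, kgraph n ->
  A) (n : nat) :
  (forall (S : {set 'I_n}) (G : kgraph n) G1 G2,
    is_gluing (@sub_in n S) (@sub_in n (~: S)) G G1 G2 ->
    w n G = w #|S| G1 * w #|~: S| G2) ->
  (\sum_(G : kgraph n) w n G) *+ n =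
  \sum_(k < n.+1) (\sum_(G : kgraph k | kconnected G) w k G) *
     (\sum_(G : kgraph (n - k)) w (n - k)%N G) *+ ('C(n, k) * k).
Proof.
move=> wM.
pose c k := \sum_(G : kgraph k | kconnected G) w k G.
pose a k := \sum_(G : kgraph k) w k G.
(* With [v] fixed, graphs are sorted by the component [S] of [v]; each [S] contributes a product of
   two independent sums. *)
have aS (v : 'I_n) : a n = \sum_(S : {set 'I_n} | v \in S) c #|S| * a #|~: S|.
  rewrite /a (partition_big (fun G => component G v) (fun S => v \in S))/=;
    last first.
    by move=> G _; rewrite inE connect0.
  apply: eq_bigr => S vS.
  transitivity (\sum_(G in [set G | component G v == S]) w n G).
    by apply: eq_bigl => G; rewrite inE.
  rewrite component_glue// big_imset/=; last by move=> x y _ _; exact: glue_inj.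
  rewrite /c /a big_distrlr/= pair_big_dep/=.
  apply: eq_big => [G12|G12 _]; first by rewrite !inE andbT.
  by apply: wM; exact: glueP.
transitivity (\sum_(v < n) a n); first by rewrite sumr_const card_ord.
(* After exchanging the sums, a set [S] of size [k] is counted once for each of its [k] elements,
   and there are ['C(n, k)] such sets. *)
rewrite (eq_bigr _ (fun v _ => aS v)) (exchange_big_dep predT)//=.
rewrite (partition_big (fun S : {set 'I_n} => inord #|S| : 'I_n.+1) predT)//=.
apply: eq_bigr => k _.
have kE (S : {set 'I_n}) : (inord #|S| == k) = (#|S| == k).
  have h : (#|S| < n.+1)%N by rewrite ltnS -[X in (_ <= X)%N](card_ord n)
    max_card.
  by rewrite -val_eqE/= inordK.
transitivity (\sum_(S : {set 'I_n} | #|S| == k) (c k * a (n - k)%N) *+ k).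
  apply: eq_big => [S|S]; first exact: kE.
  rewrite kE => /eqP Sk.
  rewrite sumr_const -Sk; congr (_ *+ _); congr (_ * a _).
  have e : (#|S| + #|~: S|)%N = n by rewrite cardsC card_ord.
  by move: (#|~: S|) (#|S|) e; lia.
rewrite sumr_const -mulrnA mulnC; congr (_ *+ (_ * _)).
have := card_draws 'I_n k; rewrite card_ord => <-; apply: eq_card => S.
by rewrite !inE.
Qed.

(** * Nonnegativity of the number of loops *)

Section ground_edges_bound.
Variables (n : nat) (G : kgraph n).

Definition inner_edges (S : {set 'I_n}) : {set edge n} :=
  [set e | (e.1 \in S) && (if G e is inl l then l \in S else false)].

(** Otherwise every path that starts in [S] would stay there, and connectedness would make [S]
    everything. *)
Lemma exists_leaving (S : {set 'I_n}) k : kconnected G -> k \in S ->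
  S != finset.setT ->
  exists k l, [/\ k \in S, l \notin S & aerial_adj G k l].
Proof.
move=> /forallP cG kS; apply: contraNP => H; apply/eqP/setP => l;
  rewrite [RHS]inE.
have /forallP/(_ l)/connectP[p] := cG k.
elim: p k kS => [|m p IH] k kS /= pp el; first by rewrite el.
move/andP: pp => [km pp]; apply: (IH m) => //.
by apply/negPn/negP => mS; apply: H; exists k, m.
Qed.

(** A spanning tree is grown: each added vertex is adjacent to the current set, and the edge
    responsible, whichever way it points, is inner only for the enlarged set. *)
Lemma exists_inner_edges m : kconnected G -> (m < n)%N ->
  exists S : {set 'I_n}, #|S| = m.+1 /\ (m <= #|inner_edges S|)%N.
Proof.
move=> cG; elim: m => [|m IH] mn; first by exists [set Ordinal mn];
  rewrite cards1.
have [S [Sm mE]] := IH (ltnW mn).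
have [k kS] : exists k, k \in S by apply/card_gt0P; rewrite Sm.
have [|k' [l [k'S lS kl]]] := exists_leaving cG kS.
  by apply/eqP => ST; move: Sm; rewrite ST cardsT card_ord => nm;
    rewrite nm ltnn in mn.
exists (l |: S); rewrite cardsU1 lS Sm; split => //.
have [e eE eN] : exists2 e, e \in inner_edges (l |: S) & e \notin inner_edges S.
  move/existsP: kl => [i /orP[/eqP Ge|/eqP Ge]].
    by exists (k', i); rewrite inE /= Ge ?(negbTE lS) ?andbF// !inE k'S eqxx
      orbT.
  by exists (l, i); rewrite inE /= Ge ?(negbTE lS)// !inE k'S eqxx orbT.
apply: (leq_ltn_trans mE); apply: proper_card; apply/properP; split;
  last by exists e.
apply/fintype.subsetP => -[k1 i]; rewrite !inE /=; case: (G _) => [k2|//].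
  by rewrite inE => /andP[-> ->]; rewrite !orbT.
by rewrite andbF.
Qed.

(** Of the [n * 2] edges at least [n - 1] join aerial vertices, by growing the tree until [S] is the
    full set. *)
Lemma ground_edges_leq : kconnected G -> (ground_edges G <= n.+1)%N.
Proof.
move=> cG.
have E : (#|inner_edges finset.setT| + ground_edges G <= n * 2)%N.
  rewrite -[X in (_ <= X)%N](_ : #|{: edge n}| = _)%N;
    last by rewrite card_prod !card_ord.
  rewrite -cardUI [X in (_ + X)%N](_ : _ = 0%N) ?addn0 ?max_card//.
  apply: eq_card0 => e; rewrite !inE.
  by case: (G e) => [l|i]; rewrite ?andbF//; apply/andP => -[_ /existsP[]].
have [n0|n0] := posnP n; first by move: E; move: #|_| => c;
  rewrite [X in (_ <= X * 2)%N]n0; lia.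
have [||S [Sn]] := @exists_inner_edges n.-1 => //; first by rewrite prednK.
have -> : S = finset.setT.
  by apply/eqP; rewrite eqEcard finset.subsetT cardsT card_ord Sn prednK/=.
by move: E; lia.
Qed.

End ground_edges_bound.

Local Open Scope classical_set_scope.
Local Open Scope ring_scope.

(** * Iterated partial derivatives *)

Lemma dist_lt_half (R : realFieldType) (a b c e : R) :
  `|a - c| < e / 2 -> `|b - c| < e / 2 -> `|a - b| < e.
Proof.
by move=> ac bc; rewrite (splitr e) (le_lt_trans (ler_distD c _ _))// ltrD//
  distrC.
Qed.

Lemma lineE (R : realType) (V : normedModType R) (f : V ->
  R) (u y : V) (t : R) :
  derivable f (y + t *: u) u ->
  is_derive t (1:R) (fun s : R => f (y + s *: u)) ('D_u f (y + t *: u)).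
Proof.
move=> du.
have E : (fun h : R => h^-1 *: (f (y + (h *: (1:R) + t) *: u) - f (y + t *:
  u))) =
         (fun h : R => h^-1 *: (f (h *: u + (y + t *: u)) - f (y + t *: u))).
  apply/funext => h; congr (_ *: (f _ - _)).
  by rewrite [h *: 1]mulr1 scalerDl addrCA.
split; first by rewrite /derivable/= E.
by rewrite /derive/= E.
Qed.

(** The second difference over the parallelogram with sides [h *: u] and [h *: v] is an increment of
    [phi]; the mean value theorem is applied to it in the direction [u], then to ['D_u f] in the
    direction [v]. *)
Lemma schwarz_mvt (R : realType) (V : normedModType R) (f : V ->
  R) (u v x : V) (h : R) :
  0 < h ->
  (forall y, derivable f y u) -> (forall y, derivable ('D_u f) y v) ->
  exists s t : R, [/\ 0 < s < h, 0 < t < h &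
    f (x + h *: u + h *: v) - f (x + h *: u) - f (x + h *: v) + f x =
    h * h * 'D_v ('D_u f) (x + s *: u + t *: v)].
Proof.
move=> h0 du dvu.
pose phi (s : R) := f ((x + h *: v) + s *: u) - f (x + s *: u).
have dphi s : is_derive s (1:R) phi ('D_u f ((x + h *: v) + s *: u) - 'D_u f (x
  + s *: u)).
  by apply: is_deriveB; exact: lineE.
have cphi : {within `[0, h], continuous phi}.
  apply: continuous_subspaceT => s; apply: differentiable_continuous.
  by apply/derivable1_diffP; have [] := dphi s.
have [s + es] := MVT h0 (fun s _ => dphi s) cphi.
rewrite in_itv/= => s0h.
pose psi (t : R) := 'D_u f ((x + s *: u) + t *: v).
have dpsi t : is_derive t (1:R) psi ('D_v ('D_u f) ((x + s *: u) + t *: v)).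
  exact: lineE.
have cpsi : {within `[0, h], continuous psi}.
  apply: continuous_subspaceT => t; apply: differentiable_continuous.
  by apply/derivable1_diffP; have [] := dpsi t.
have [t + et] := MVT h0 (fun t _ => dpsi t) cpsi.
rewrite in_itv/= => t0h.
exists s, t; split => //.
move: es et; rewrite /phi /psi !scale0r !addr0 !subr0 => es et.
rewrite addrAC in et; rewrite et in es.
rewrite [RHS]mulrC mulrA -es (addrAC x) opprB.
by rewrite (addrC (f x)) addrA.
Qed.

(** The second difference is symmetric in [u] and [v], so it is [h * h] times either mixed
    derivative at some point of the same small parallelogram; continuity at [x] does the rest. *)
Lemma schwarz (R : realType) (V : normedModType R) (f : V -> R) (u v x : V) :
  (forall y, derivable f y u) -> (forall y, derivable ('D_u f) y v) ->
  (forall y, derivable f y v) -> (forall y, derivable ('D_v f) y u) ->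
  {for x, continuous ('D_v ('D_u f))} -> {for x, continuous ('D_u ('D_v f))} ->
  'D_v ('D_u f) x = 'D_u ('D_v f) x.
Proof.
move=> du dvu dv duv cvu cuv.
apply/eqP; rewrite -subr_eq0 -normr_le0; apply/ler_addgt0Pl => e e0;
  rewrite addr0.
have e20 : 0 < e / 2 by rewrite divr_gt0.
have /cvgrPdist_lt /(_ _ e20) /nbhs_ballP[d1 /= d10 H1] := cvu.
have /cvgrPdist_lt /(_ _ e20) /nbhs_ballP[d2 /= d20 H2] := cuv.
pose d := Num.min d1 d2.
have d0 : 0 < d by rewrite lt_min d10.
(* [M] bounds the parallelogram relative to [h]; the summand 1 keeps it positive even if [u] and [v]
   vanish. *)
pose M := `|u| + `|v| + 1.
have M0 : 0 < M by rewrite ltr_pwDr.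
have [h h0 dE] : exists2 h : R, 0 < h & d = h * M.
  by exists (d / M); rewrite ?divr_gt0// divfK// gt_eqF.
have B s t : 0 < s < h -> 0 < t < h -> ball x d (x + s *: u + t *: v).
  move=> /andP[s0 sh] /andP[t0 th]; rewrite -ball_normE /ball_ /=.
  rewrite opprD addrA opprD addrA subrr sub0r -opprD normrN.
  apply: (le_lt_trans (ler_normD _ _));
    rewrite !normrZ (gtr0_norm s0) (gtr0_norm t0).
  rewrite dE.
  apply: (@le_lt_trans _ _ (h * (`|u| + `|v|))).
    by rewrite mulrDr lerD// ler_wpM2r// ltW.
  by rewrite ltr_pM2l// /M ltrDl.
have [s1 [t1 [s1h t1h E1]]] := schwarz_mvt x h0 du dvu.
have [s2 [t2 [s2h t2h E2]]] := schwarz_mvt x h0 dv duv.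
have E : 'D_v ('D_u f) (x + s1 *: u + t1 *: v) =
  'D_u ('D_v f) (x + s2 *: v + t2 *: u).
  apply: (@mulfI _ (h * h)); first by rewrite mulf_neq0// gt_eqF.
  apply: etrans (esym E1) (etrans _ E2); congr (_ + _).
  by rewrite (addrAC x (h *: v)) [RHS]addrAC.
have B1 := B _ _ s1h t1h; have := B _ _ t2h s2h; rewrite addrAC => B2.
have dd1 : d <= d1 by rewrite ge_min lexx.
have dd2 : d <= d2 by rewrite ge_min lexx orbT.
have := H1 _ (le_ball dd1 B1); have := H2 _ (le_ball dd2 B2).
rewrite -E /=; set a := 'D_v _ x; set b := 'D_u _ x; set c := 'D_v _ _.
move=> hb ha.
exact: ltW (dist_lt_half ha hb).
Qed.

Section pderivs.
Context {R : realType} {d : nat}.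
Implicit Types (f g : 'rV[R]_d -> R) (x p : 'rV[R]_d).

Lemma pderivs_cat f s t : pderivs f (s ++ t) = pderivs (pderivs f t) s.
Proof. by rewrite /pderivs foldr_cat. Qed.

Lemma smooth_pderivs f s : smooth f -> smooth (pderivs f s).
Proof. by move=> fs t; rewrite -pderivs_cat; exact: fs. Qed.

Lemma pderivC f i j : smooth f -> pderiv (pderiv f i) j = pderiv (pderiv f j) i.
Proof.
move=> sf; apply/funext => x; apply: schwarz => [y|y|y|y||].
- exact: (sf [::]).2.
- exact: (sf [:: i]).2.
- exact: (sf [::]).2.
- exact: (sf [:: j]).2.
- exact: (sf [:: j; i]).1.
- exact: (sf [:: i; j]).1.
Qed.

Lemma pderivs_insert f s i t : smooth f ->
  pderivs f (s ++ i :: t) = pderivs f (i :: s ++ t).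
Proof.
move=> sf; elim: s => //= j s ->/=.
by apply: pderivC; exact: smooth_pderivs.
Qed.

(** [incoming] lists indices in the order of the edge enumeration, which gluing shuffles, and
    [diffop] imposes an order of its own; this lemma reconciles them. *)
Lemma perm_pderivs f s t : smooth f -> perm_eq s t -> pderivs f s = pderivs f t.
Proof.
move=> sf; elim: s t => [|i s IH] t; first by rewrite perm_sym => /perm_nilP ->.
move=> st; have it : i \in t by rewrite -(perm_mem st) mem_head.
case/splitPr: it st => t1 t2 st.
move: st; rewrite perm_sym -cat_rcons -cats1 -catA perm_catCA/= perm_cons
  perm_sym => st.
by rewrite pderivs_insert//= (IH _ st).
Qed.

End pderivs.

Lemma derive_lineP (R : realType) (V : normedModType R) (f : V ->
  R) (v x : V) (c : R) :
  is_derive (0 : R) (1 : R) (fun h : R => f (x + h *: v)) c -> 'D_v f x = c.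
Proof.
move=> [_ <-]; rewrite /derive.
suff -> : (fun h : R => h^-1 *: (f (h *: v + x) - f x)) =
    (fun h : R => h^-1 *: (f (x + (h *: (1:R) + 0) *: v) - f (x + (0 : R) *:
      v))) by [].
apply/funext => h; congr (_ *: (f _ - f _)); last by rewrite scale0r addr0.
by rewrite [h *: 1]mulr1 addr0 addrC.
Qed.

Lemma is_derive_line (R : realType) (V : normedModType R) (f : V ->
  R) (v x : V) :
  derivable f x v ->
  is_derive (0 : R) (1 : R) (fun h : R => f (x + h *: v)) ('D_v f x).
Proof.
by move=> df; have := @lineE R V f v x 0; rewrite scale0r addr0; exact.
Qed.

Section pderivs_examples.
Context {R : realType} {d : nat}.
Implicit Types (f g : 'rV[R]_d -> R) (x p : 'rV[R]_d).

Lemma dotv_line p x i t : dotv p (x + t *: delta_mx 0 i) = t * p 0 i + dotv p x.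
Proof.
rewrite addrC /dotv; under eq_bigr do rewrite !mxE mulrDr eqxx/=.
rewrite big_split/=; congr (_ + _);
  rewrite (bigD1 i)//= eqxx mulr1 mulrC big1 ?addr0// => j ji.
by rewrite (negbTE ji) !mulr0.
Qed.

Lemma pderiv_exp_fun p c i : pderiv (fun x => c * exp_fun p x) i =
  (fun x => (p 0 i * c) * exp_fun p x).
Proof.
apply/funext => x; apply: derive_lineP.
have -> : (fun h : R => c * exp_fun p (x + h *: delta_mx 0 i)) =
    (c * exp_fun p x) \*: (fun h : R => expR (h * p 0 i)).
  by apply/funext => h /=;
    rewrite /exp_fun dotv_line expRD [_ *: _]mulrAC mulrA.
have e : is_derive (0 : R) (1 : R) (fun h : R => expR (h * p 0 i)) (p 0 i).
  have {2}-> : p 0 i = expR (p 0 i * 0) *: (p 0 i *: (1 : R)).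
    by rewrite mulr0 expR0 scale1r [_ *: _]mulr1.
  have -> : (fun h : R => expR (h * p 0 i)) = expR \o (p 0 i \*: id).
    by apply/funext => h /=; rewrite mulrC.
  exact: is_derive1_comp.
apply: is_derive_eq.
by rewrite [_ *: _]mulrC mulrA.
Qed.

Lemma pderivs_exp_fun p s :
  pderivs (exp_fun p) s = (fun x => (\prod_(i <- s) p 0 i) * exp_fun p x).
Proof.
elim: s => [|i s IH]; first by apply/funext => x; rewrite big_nil mul1r.
by rewrite /= IH pderiv_exp_fun; apply/funext => x; rewrite big_cons.
Qed.

Definition lefts (s : seq 'I_(d + d)) : seq 'I_d :=
  pmap (fun i : 'I_(d + d) => if fintype.split i is inl k then Some k else
    None) s.
Definition rights (s : seq 'I_(d + d)) : seq 'I_d :=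
  pmap (fun i : 'I_(d + d) => if fintype.split i is inr k then Some k else
    None) s.

Lemma lsubmx_delta (k : 'I_d) :
  lsubmx (delta_mx 0 (lshift d k) : 'rV[R]_(d + d)) = delta_mx 0 k /\
  rsubmx (delta_mx 0 (lshift d k) : 'rV[R]_(d + d)) = 0.
Proof.
split; apply/rowP => j; rewrite !mxE eqxx/=.
  by rewrite (inj_eq (@lshift_inj _ _)).
by rewrite eq_rlshift.
Qed.

Lemma rsubmx_delta (k : 'I_d) :
  rsubmx (delta_mx 0 (rshift d k) : 'rV[R]_(d + d)) = delta_mx 0 k /\
  lsubmx (delta_mx 0 (rshift d k) : 'rV[R]_(d + d)) = 0.
Proof.
split; apply/rowP => j; rewrite !mxE eqxx/=.
  by rewrite (inj_eq (@rshift_inj _ _)).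
by rewrite eq_lrshift.
Qed.

Lemma pderiv_tensorl f g k : (forall x, derivable f x (delta_mx 0 k)) ->
  pderiv (tensor f g) (lshift d k) = tensor (pderiv f k) g.
Proof.
move=> df; apply/funext => z; apply: derive_lineP; rewrite /tensor.
have [e1 e2] := lsubmx_delta k.
have -> : (fun h : R =>
    f (lsubmx (z + h *: delta_mx 0 (lshift d k))) *
    g (rsubmx (z + h *: delta_mx 0 (lshift d k)))) =
    g (rsubmx z) \*: (fun h : R => f (lsubmx z + h *: delta_mx 0 k)).
  apply/funext => h /=;
    rewrite ![z + _]addrC !linearP/= e1 e2 scaler0 add0r [_ + lsubmx z]addrC;
    exact: mulrC.
rewrite mulrC; apply: is_deriveZ; exact: is_derive_line.
Qed.

Lemma pderiv_tensorr f g k : (forall x, derivable g x (delta_mx 0 k)) ->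
  pderiv (tensor f g) (rshift d k) = tensor f (pderiv g k).
Proof.
move=> df; apply/funext => z; apply: derive_lineP; rewrite /tensor.
have [e1 e2] := rsubmx_delta k.
have -> : (fun h : R =>
    f (lsubmx (z + h *: delta_mx 0 (rshift d k))) *
    g (rsubmx (z + h *: delta_mx 0 (rshift d k)))) =
    f (lsubmx z) \*: (fun h : R => g (rsubmx z + h *: delta_mx 0 k)).
  by apply/funext => h /=;
    rewrite ![z + _]addrC !linearP/= e1 e2 scaler0 add0r [_ + rsubmx z]addrC.
by apply: is_deriveZ; exact: is_derive_line.
Qed.

Lemma pderivs_tensor f g s : smooth f -> smooth g ->
  pderivs (tensor f g) s = tensor (pderivs f (lefts s)) (pderivs g (rights s)).
Proof.
move=> sf sg; elim: s => [//|i s IH]; rewrite [LHS]/= IH /lefts /rights/=.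
case: (splitP i) => [j ij|j ij].
  rewrite (_ : i = lshift d j) ?pderiv_tensorl//; last exact: val_inj.
  exact: (sf _).2.
rewrite (_ : i = rshift d j) ?pderiv_tensorr//; last exact: val_inj.
exact: (sg _).2.
Qed.

Lemma perm_pderivs_tensor f g s t : smooth f -> smooth g -> perm_eq s t ->
  pderivs (tensor f g) s = pderivs (tensor f g) t.
Proof.
move=> sf sg st; rewrite !pderivs_tensor//.
by congr tensor; apply: perm_pderivs => //; exact: perm_pmap.
Qed.

End pderivs_examples.

(** * Symbols *)

Section mpoly_fun.
Variable R : realType.

Lemma poly_fun_eq0 (p : {poly R}) : (forall t, p.[t] = 0) -> p = 0.
Proof.
move=> p0; apply/eqP/negPn/negP => pN0.
have := @max_poly_roots _ p [seq i%:R | i <- iota 0 (size p)] pN0.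
rewrite size_map size_iota ltnn => H; apply/notF/H.
  by apply/allP => t _; rewrite /root p0.
by rewrite map_inj_uniq ?iota_uniq// => i j /eqP; rewrite eqr_nat => /eqP.
Qed.

(** Uniqueness of base [N] expansions, by remainder and quotient modulo [N]; it keeps the exponents
    in Kronecker's substitution distinct. *)
Lemma base_digits_inj k (N : nat) (m m' : 'I_k -> nat) :
  (forall i, m i < N)%N -> (forall i, m' i < N)%N ->
  (\sum_(i < k) m i * N ^ i = \sum_(i < k) m' i * N ^ i)%N -> m =1 m'.
Proof.
elim: k m m' => [|k IH] m m' mN m'N; first by move=> _ [].
have E (u : 'I_k.+1 -> nat) : (\sum_(i < k.+1) u i * N ^ i =
    u ord0 + (\sum_(i < k) u (lift ord0 i) * N ^ i) * N)%N.
  rewrite big_ord_recl expn0 muln1 big_distrl/=; congr (_ + _)%N.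
  by apply: eq_bigr => i _; rewrite /bump/= add1n expnSr mulnA.
rewrite !E => e.
have N0 : (0 < N)%N by exact: leq_ltn_trans (mN ord0).
have e0 : m ord0 = m' ord0.
  have := congr1 (modn^~ N) e; rewrite ![(_ + _ * _)%N]addnC !modnMDl.
  by rewrite !modn_small.
have e1 : (fun i => m (lift ord0 i)) =1 (fun i => m' (lift ord0 i)).
  apply: IH => //.
  by apply/eqP; rewrite -(eqn_pmul2r N0); move: e; rewrite e0 => /addnI ->.
by move=> i; case: (unliftP ord0 i) => [j|] ->.
Qed.

(* Kronecker's substitution [X_i := t ^ (N ^ i)] reduces to one variable. *)
Lemma mpoly_fun_eq0 k (P : mpoly k R) : (forall v, meval v P = 0) -> P = 0.
Proof.
move=> P0; pose N := msize P.
pose kap (m : multinom k) := (\sum_(i < k) m i * N ^ i)%N.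
pose p : {poly R} := \sum_(m <- msupp P) mcoeff m P *: 'X^(kap m).
have p0 : p = 0.
  apply: poly_fun_eq0 => t; rewrite -[RHS](P0 (fun i => t ^+ (N ^ i))) mevalE.
  rewrite horner_sum; apply: eq_bigr => m _; rewrite hornerZ hornerXn;
    congr (_ * _).
  rewrite (big_morph (GRing.exp t) (exprD t) (expr0 t)).
  by apply: eq_bigr => i _; rewrite -exprM mulnC.
(* [N] exceeds the total degree, so the exponents of a monomial are digits in base [N]. *)
have mN (m : multinom k) : m \in msupp P -> forall i, (m i < N)%N.
  move=> mP i; apply: leq_ltn_trans (msize_mdeg_lt mP).
  by rewrite mdegE (bigD1 i)//= leq_addr.
apply/mpolyP => m; rewrite mcoeff0.
have [mP|] := boolP (m \in msupp P); last by rewrite mcoeff_msupp negbK => /eqP.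
have := congr1 (fun q : {poly R} => q`_(kap m)) p0; rewrite coef0 coef_sum.
rewrite (bigD1_seq m) ?msupp_uniq//= coefZ coefXn eqxx mulr1 big_seq_cond big1
  ?addr0//.
move=> m' /andP[m'P m'm]; rewrite coefZ coefXn.
case: eqP => [e|_]; last by rewrite mulr0.
case/eqP: m'm; apply/mnmP; apply: (base_digits_inj (mN _ m'P) (mN _ mP)).
exact: esym e.
Qed.

End mpoly_fun.

Section monomials.
Variables (R : realType) (k : nat).

Definition smon (s : seq 'I_k) : mpoly k R := \prod_(i <- s) mpolyX R (mnm1 i).

Lemma smon_cat s t : smon (s ++ t) = smon s * smon t.
Proof. exact: big_cat. Qed.

Lemma perm_smon s t : perm_eq s t -> smon s = smon t.
Proof. exact: perm_big. Qed.

Lemma meval_smon v s : meval v (smon s) = \prod_(i <- s) v i.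
Proof.
rewrite /smon; elim: s => [|i s IH]; first by rewrite !big_nil meval1.
by rewrite !big_cons mevalM mevalXU IH.
Qed.

Definition smnm (s : seq 'I_k) : multinom k :=
  \big[mnm_add/mnm0]_(i <- s) mnm1 i.

Lemma smonE s : smon s = mpolyX R (smnm s).
Proof.
rewrite /smon /smnm; elim: s => [|i s IH]; first by rewrite !big_nil mpolyX0.
by rewrite !big_cons IH -mpolyXD.
Qed.

Lemma smnmE s i : smnm s i = count_mem i s.
Proof.
rewrite /smnm; elim: s => [|j s IH]; first by rewrite big_nil mnm0E.
by rewrite big_cons mnmDE IH mnm1E.
Qed.

Lemma mdeg_smnm s : mdeg (smnm s) = size s.
Proof.
rewrite /smnm; elim: s => [|j s IH]; first by rewrite big_nil mdeg0.
by rewrite big_cons mdegD IH mdeg1.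
Qed.

(** [diffop] applies the derivatives of a monomial in one fixed order; this property allows any
    other. *)
Definition perm_pderivs_stable (F : 'rV[R]_k -> R) :=
  forall s t, perm_eq s t -> pderivs F s = pderivs F t.

(** The supports of [P], [Q] and [P + Q] may differ; summing over a common range of monomials makes
    linearity visible. *)
Lemma diffop_le N (P : mpoly k R) F z : (msize P <= N)%N -> diffop P F z =
  \sum_(q : bmultinom k N) mcoeff q P * pderivs F (flatten [seq nseq (q i) i |
    i <- enum 'I_k]) z.
Proof.
move=> PN; rewrite /diffop (big_mksub (bmultinom k N))/=; last 2 first.
- exact: msupp_uniq.
- by move=> m /msize_mdeg_lt /leq_trans; exact.
by rewrite big_rmcond //= => i; move/memN_msupp_eq0 ->; rewrite mul0r.
Qed.

Lemma diffop0 F z : diffop (0 : mpoly k R) F z = 0.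
Proof. by rewrite (@diffop_le 0) ?msize0// big1// => q _;
  rewrite mcoeff0 mul0r. Qed.

Lemma diffopD (P Q : mpoly k R) F z : diffop (P + Q) F z =
  diffop P F z + diffop Q F z.
Proof.
pose N := maxn (msize P) (msize Q).
rewrite !(@diffop_le N) ?leq_maxl ?leq_maxr ?msizeD_le// -big_split/=.
by apply: eq_bigr => q _; rewrite mcoeffD mulrDl.
Qed.

Lemma diffopZ c (P : mpoly k R) F z : diffop (c *: P) F z = c * diffop P F z.
Proof.
rewrite !(@diffop_le (msize P)) ?msizeZ_le// mulr_sumr.
by apply: eq_bigr => q _; rewrite mcoeffZ mulrA.
Qed.

Lemma diffop_sum (I : finType) (P : I -> mpoly k R) F z :
  diffop (\sum_i P i) F z = \sum_i diffop (P i) F z.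
Proof. exact: (big_morph (fun P => diffop P F z) (fun P Q => diffopD P Q F z)
  (diffop0 F z)). Qed.

Lemma diffop_smon s F z : perm_pderivs_stable F ->
  diffop (smon s) F z = pderivs F s z.
Proof.
move=> Fs; rewrite smonE /diffop msuppX big_seq1 mcoeffX eqxx mul1r.
congr (_ z); apply: Fs; apply/allP => i _ /=; apply/eqP.
rewrite count_flatten -map_comp.
rewrite (eq_map (g := fun j => ((j == i) * smnm s j)%N)); last first.
  by move=> j /=; rewrite count_nseq.
rewrite sumnE big_map big_enum/= (bigD1 i)//= eqxx mul1n big1 ?addn0 ?smnmE//.
by move=> j /negbTE ->.
Qed.

End monomials.

Section glue_big.
Variables (n a b : nat) (s : 'I_a -> 'I_n) (t : 'I_b -> 'I_n).
Hypothesis st : vertex_split s t.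
Let s_inj := split_injl st.
Let t_inj := split_injr st.
Let st_disj := split_disj st.
Let st_cover := split_cover st.

Definition st_sum (x : 'I_a + 'I_b) : 'I_n :=
  match x with inl k => s k | inr l => t l end.

Lemma st_sum_bij : bijective st_sum.
Proof.
have st_inj : injective st_sum.
  move=> [k|k] [l|l] /= e.
  - by rewrite (s_inj e).
  - by have := st_disj k l; rewrite e eqxx.
  - by have := st_disj l k; rewrite e eqxx.
  - by rewrite (t_inj e).
apply: (inj_card_bij st_inj).
rewrite -(card_codom st_inj); apply: subset_leq_card;
  apply/fintype.subsetP => m _.
by apply/codomP; case: (st_cover m) => -[k ->]; [exists (inl k)|exists (inr k)].
Qed.

Lemma big_glue (A : Type) (idx : A) (op : Monoid.com_law idx) (F : 'I_n -> A) :
  \big[op/idx]_(k < n) F k =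
  op (\big[op/idx]_(k < a) F (s k)) (\big[op/idx]_(k < b) F (t k)).
Proof.
by rewrite (reindex st_sum) ?big_sumType//; apply: onW_bij; exact: st_sum_bij.
Qed.

Let se (e : edge a) : edge n := (s e.1, e.2).
Let te (e : edge b) : edge n := (t e.1, e.2).

Lemma perm_enum_edges :
  perm_eq (enum {: edge n}) (map se (enum {: edge a}) ++ map te (enum {: edge
    b})).
Proof.
apply: uniq_perm; first exact: enum_uniq.
  have se_inj : injective se by move=> [k i] [l j] [/s_inj -> ->].
  have te_inj : injective te by move=> [k i] [l j] [/t_inj -> ->].
  rewrite cat_uniq (map_inj_uniq se_inj) (map_inj_uniq te_inj) !enum_uniq
    andbT/=.
  apply/hasPn => e /mapP[[k i] _ ->]; apply/mapP => -[[l j] _ [/eqP]].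
  by rewrite eq_sym (negbTE (st_disj _ _)).
move=> [m i]; rewrite mem_enum inE mem_cat; apply/esym/orP.
case: (st_cover m) => -[k ->]; [left|right]; apply/mapP.
  by exists (k, i); rewrite ?mem_enum.
by exists (k, i); rewrite ?mem_enum.
Qed.

Variables (d : nat) (G : kgraph n) (G1 : kgraph a) (G2 : kgraph b).
Hypothesis gl : is_gluing s t G G1 G2.

Variables (I : {ffun edge n -> 'I_d}) (I1 : {ffun edge a ->
  'I_d}) (I2 : {ffun edge b -> 'I_d}).
Hypotheses (II1 : forall e, I (se e) = I1 e) (II2 : forall e, I (te e) = I2 e).

Lemma perm_incoming v : perm_eq (incoming G I v)
  ([seq I1 e | e <- enum {: edge a} & vmap s (G1 e) == v] ++
   [seq I2 e | e <- enum {: edge b} & vmap t (G2 e) == v]).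
Proof.
rewrite /incoming (perm_trans (perm_map _ (perm_filter _ perm_enum_edges)))//.
rewrite filter_cat map_cat !filter_map -!map_comp/=.
rewrite (eq_map (g := I1)); last by move=> e /=; exact: II1.
rewrite (eq_map (g := I2)); last by move=> e /=; exact: II2.
rewrite (eq_filter (a2 := fun e => vmap s (G1 e) == v)); last first.
  by move=> [k i] /=; rewrite gl.1.
by rewrite [X in _ ++ map _ X](eq_filter (a2 :=
  fun e => vmap t (G2 e) == v))// => -[k i] /=; rewrite gl.2.
Qed.

Lemma perm_incomingl k : perm_eq (incoming G I (inl (s k))) (incoming G1 I1
  (inl k)).
Proof.
apply: (perm_trans (perm_incoming _)).
rewrite [X in _ ++ map _ X](eq_filter (a2 := pred0)) ?filter_pred0 ?cats0;
  last first.
  move=> e /=; apply/eqP; case: (G2 e) => //= l [/eqP].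
  by rewrite eq_sym (negbTE (st_disj _ _)).
rewrite /incoming (eq_filter (a2 := fun e => G1 e == inl k))// => e /=.
by apply/eqP/eqP => [|->//]; exact: (vmap_inj s_inj (x2 := inl _)).
Qed.

Lemma perm_incomingr k : perm_eq (incoming G I (inl (t k))) (incoming G2 I2
  (inl k)).
Proof.
apply: (perm_trans (perm_incoming _)).
rewrite (eq_filter (a2 := pred0)) ?filter_pred0 ?cat0s; last first.
  by move=> e /=; apply/eqP; case: (G1 e) => //= l [/eqP];
    rewrite (negbTE (st_disj _ _)).
rewrite /incoming (eq_filter (a2 := fun e => G2 e == inl k))// => e /=.
by apply/eqP/eqP => [|->//]; exact: (vmap_inj t_inj (x2 := inl _)).
Qed.

Lemma perm_incoming_ground i :
  perm_eq (incoming G I (inr i)) (incoming G1 I1 (inr i) ++ incoming G2 I2 (inr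
    i)).
Proof.
apply: (perm_trans (perm_incoming _)).
rewrite /incoming (eq_filter (a2 := fun e => G1 e == inr i)); last first.
  by move=> e /=; case: (G1 e).
by rewrite [X in _ ++ map _ X](eq_filter (a2 :=
  fun e => G2 e == inr i))// => e /=; case: (G2 e).
Qed.

End glue_big.

Lemma ord2P (i : 'I_2) : {i = ord0} + {i = ord_max}.
Proof. by case: i => [[|[|//]] i2]; [left|right]; apply: val_inj. Qed.

Section symbols.
Context {R : realType} {d : nat}.
Variables (alpha : 'I_d -> 'I_d -> 'rV[R]_d -> R) (x : 'rV[R]_d).

(** On exponentials, a derivative [i] at the first ground vertex multiplies by entry [i] of [p1],
    the variable [lshift d i]; at the second, by entry [i] of [p2], the variable [rshift d i]. *)
Definition psym_term n (G : kgraph n) (I : {ffun edge n ->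
  'I_d}) : mpoly (d + d) R :=
  (\prod_(k < n) pderivs (alpha (I (k, ord0)) (I (k, ord_max)))
                         (incoming G I (inl k)) x) *:
  (smon R (map (lshift d) (incoming G I (inr ord0))) *
   smon R (map (@rshift d d) (incoming G I (inr ord_max)))).

Definition psym n (G : kgraph n) : mpoly (d + d) R :=
  \sum_(I : {ffun edge n -> 'I_d}) psym_term G I.

Lemma is_symbol_psym n (G : kgraph n) : is_symbol alpha G x (psym G).
Proof.
move=> p1 p2; rewrite /psym (big_morph _ (mevalD (row_mx p1 p2 0)) (meval0 _))
  /kop mulr_suml.
apply: eq_bigr => I _;
  rewrite !pderivs_exp_fun /psym_term mevalZ mevalM !meval_smon !big_map.
under [X in _ = _ * (X * _) * _]eq_bigr do rewrite row_mxEl.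
under [X in _ = _ * (_ * X) * _]eq_bigr do rewrite row_mxEr.
have -> : exp_fun (p1 + p2) x = exp_fun p1 x * exp_fun p2 x.
  rewrite /exp_fun -expRD /dotv -big_split/=; congr expR.
  by apply: eq_bigr => i _; rewrite mxE mulrDl.
by rewrite !mulrA; congr (_ * _); rewrite -!mulrA; congr (_ * (_ * _));
  rewrite mulrC.
Qed.

(** Two polynomials with the defining property agree at every point, as the exponential factor is
    nonzero, and hence coincide; existence excludes the default value of [xget]. *)
Lemma symbolE n (G : kgraph n) : symbol alpha G x = psym G.
Proof.
rewrite /symbol; case: xgetP => [P _ symP|/(_ (psym G)) []];
  last exact: is_symbol_psym.
apply/eqP; rewrite -subr_eq0; apply/eqP/mpoly_fun_eq0 => v.
pose p1 : 'rV[R]_d := \row_i v (lshift d i).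
pose p2 : 'rV[R]_d := \row_i v (rshift d i).
have vE : row_mx p1 p2 0 =1 v.
  move=> i; case: (splitP i) => j ij.
    by rewrite (_ : i = lshift d j) ?row_mxEl ?mxE//; exact: val_inj.
  by rewrite (_ : i = rshift d j) ?row_mxEr ?mxE//; exact: val_inj.
rewrite -(meval_eq _ vE) mevalB; apply/eqP; rewrite subr_eq0; apply/eqP.
have := is_symbol_psym G p1 p2; rewrite (symP p1 p2).
by apply: mulIf; rewrite gt_eqF// expR_gt0.
Qed.

Lemma mcoeff_psym_deg n (G : kgraph n) q : mcoeff q (psym G) != 0 ->
  mdeg q = ground_edges G.
Proof.
apply: contraNeq => qG; rewrite /psym raddf_sum/= big1// => I _.
rewrite /psym_term mcoeffZ -smon_cat smonE mcoeffX.
case: eqP => [qE|]; last by rewrite mulr0.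
case/eqP: qG; rewrite -qE mdeg_smnm size_cat !size_map !size_filter
  /ground_edges.
have countE (P : pred (edge n)) : count P (enum {: edge n}) = #|P|.
  by rewrite -sum1_card -sum1_count big_enum_cond.
(* No edge lands at both ground vertices, so the two counts add up. *)
rewrite !countE -cardUI [X in (_ + X)%N]eq_card0 ?addn0.
  apply: eq_card => e; rewrite !inE; apply/orP/existsP => [[h|h]|[i ]];
    [by exists ord0|by exists ord_max|].
  by case: (ord2P i) => ->; [left|right].
by move=> e; apply/negbTE/negP => /andP[/eqP + /eqP] => /= ->.
Qed.

(** The symbol acts on [f(x')g(x'')] with its coefficients frozen at [x]; the two halves of the
    [d + d] variables carry the derivatives of [f] and of [g]. *)
Lemma kop_psym n (G : kgraph n) f g : smooth f -> smooth g ->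
  kop alpha G f g x = diffop (psym G) (tensor f g) (row_mx x x).
Proof.
move=> sf sg; rewrite /kop /psym diffop_sum; apply: eq_bigr => I _.
rewrite /psym_term diffopZ -smon_cat diffop_smon; last first.
  by move=> s t; exact: perm_pderivs_tensor.
rewrite pderivs_tensor// /tensor row_mxKl row_mxKr -mulrA;
  congr (_ * (pderivs f _ x * pderivs g _ x)).
- rewrite /lefts pmap_cat [X in _ ++ X](_ : _ = [::]) ?cats0.
    by elim: (incoming G I (inr ord0)) => //= i s <-;
      rewrite (unsplitK (inl i)).
  by elim: (incoming G I (inr ord_max)) => //= i s IH;
    rewrite (unsplitK (inr i)).
- rewrite /rights pmap_cat [X in X ++ _](_ : _ = [::]) ?cat0s.
    by elim: (incoming G I (inr ord_max)) => //= i s <-;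
      rewrite (unsplitK (inr i)).
  by elim: (incoming G I (inr ord0)) => //= i s IH; rewrite (unsplitK (inl i)).
Qed.

Hypothesis salpha : forall i j, smooth (alpha i j).

Lemma psym_gluing n a b (s : 'I_a -> 'I_n) (t : 'I_b -> 'I_n) :
  vertex_split s t ->
  forall G G1 G2, is_gluing s t G G1 G2 -> psym G = psym G1 * psym G2.
Proof.
move=> st G G1 G2 gl.
rewrite /psym big_distrlr/= pair_big/=.
(* An index assignment on [G] is a pair of assignments on the parts; injectivity and equal
   cardinalities give the bijection. *)
pose res (I : {ffun edge n -> 'I_d}) : {ffun edge a -> 'I_d} * {ffun edge b ->
  'I_d} :=
  ([ffun e => I (s e.1, e.2)], [ffun e => I (t e.1, e.2)]).
rewrite (reindex res)/=; last first.
  apply: onW_bij; apply: inj_card_bij.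
    move=> I J [/ffunP e1 /ffunP e2]; apply/ffunP => -[m i].
    case: (split_cover st m) => -[k ->].
      by have := e1 (k, i); rewrite !ffunE.
    by have := e2 (k, i); rewrite !ffunE.
  rewrite card_prod !card_ffun !card_prod !card_ord -expnD -mulnDl.
  by have := bij_eq_card (st_sum_bij st); rewrite card_sum !card_ord => ->.
apply: eq_bigr => I _.
set I1 := [ffun e => I (s e.1, _)]; set I2 := [ffun e => I (t e.1, _)].
have II1 e : I (s e.1, e.2) = I1 e by rewrite ffunE.
have II2 e : I (t e.1, e.2) = I2 e by rewrite ffunE.
rewrite /psym_term (big_glue st).
rewrite -scalerAl -scalerAr scalerA; congr (_ * _ *: _).
- apply: eq_bigr => k _.
  rewrite (perm_pderivs (salpha _ _) (perm_incomingl st gl II1 II2 k)).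
  by rewrite -(II1 (k, ord0)) -(II1 (k, ord_max)).
- apply: eq_bigr => k _.
  rewrite (perm_pderivs (salpha _ _) (perm_incomingr st gl II1 II2 k)).
  by rewrite -(II2 (k, ord0)) -(II2 (k, ord_max)).
have ground i := perm_incoming_ground st gl II1 II2 i.
rewrite (perm_smon R (perm_map _ (ground ord0))) (perm_smon R (perm_map _
  (ground ord_max))).
by rewrite !map_cat !smon_cat mulrACA.
Qed.

End symbols.

(** * Product measures *)

Section Rintegral_product.
Context {R : realType} {d1 d2 : measure_display}
  {T1 : measurableType d1} {T2 : measurableType d2}.
Variables (m1 : {sigma_finite_measure set T1 -> \bar R})
          (m2 : {sigma_finite_measure set T2 -> \bar R}).

(* [fine] sends the infinite or undefined integral of a non-integrable function to 0. *)
Lemma Rintegral_nonintegrable (d : measure_display) (T : measurableType d)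
    (mu : {measure set T -> \bar R}) (f : T -> R) :
  measurable_fun setT f -> ~ mu.-integrable setT (EFin \o f) ->
  \int[mu]_x f x = 0.
Proof.
move=> mf nf; have mEf : measurable_fun setT (EFin \o f) by
  exact/measurable_EFinP.
rewrite /Rintegral integralE.
have P0 : (0 <= \int[mu]_x (EFin \o f)^\+ x)%E by exact: integral_ge0.
have N0 : (0 <= \int[mu]_x (EFin \o f)^\- x)%E by exact: integral_ge0.
(* So one of the two parts has infinite integral. Their difference is then infinite, by convention
   even for [+oo - +oo], and [fine] sends it to 0. *)
have : (\int[mu]_x (EFin \o f)^\+ x + \int[mu]_x (EFin \o f)^\- x = +oo)%E.
  rewrite -ge0_integralD//;
    [|exact: measurable_funepos|exact: measurable_funeneg].
  apply/eqP; rewrite eq_le leey/= leNgt; apply/negP => h; apply: nf.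
  apply/integrableP; split => //; apply: le_lt_trans h.
  rewrite le_eqVlt; apply/orP; left; apply/eqP; apply: eq_integral => x _.
  by rewrite -[LHS]/((abse \o (EFin \o f)) x) fune_abse.
by case: (integral _ _ (_ ^\+)%E) P0 => [r| |]//;
  case: (integral _ _ _) N0 => [s| |].
Qed.

(* No integrability is needed: if f or g is not integrable, then the integral of
   |f g| is either 0 or +oo, and both sides are 0. *)
Lemma Rintegral_prod (f : T1 -> R) (g : T2 -> R) :
  measurable_fun setT f -> measurable_fun setT g ->
  \int[(m1 \x m2)%E]_z (f z.1 * g z.2) = \int[m1]_x f x * \int[m2]_y g y.
Proof.
move=> mf mg.
pose h (z : T1 * T2) := f z.1 * g z.2.
have mh : measurable_fun setT h.
  by apply: measurable_funM; apply: measurableT_comp.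
have mEf : measurable_fun setT (EFin \o f) by exact/measurable_EFinP.
have mEg : measurable_fun setT (EFin \o g) by exact/measurable_EFinP.
have mEh : measurable_fun setT (EFin \o h) by exact/measurable_EFinP.
have mabs d (T : measurableType d) (u : T -> R) : measurable_fun setT u ->
    measurable_fun setT (fun x => `|(u x)%:E|)%E.
  by move=> mu; apply: measurableT_comp => //; exact/measurable_EFinP.
have tonelli : (\int[m1 \x m2]_z `|(h z)%:E| =
    \int[m1]_x `|(f x)%:E| * \int[m2]_y `|(g y)%:E|)%E.
  rewrite fubini_tonelli1//; last exact: mabs.
  rewrite -ge0_integralZr//; [|exact: mabs|exact: integral_ge0].
  apply: eq_integral => x _; rewrite /fubini_F -ge0_integralZl//;
    last exact: mabs.
  by apply: eq_integral => y _; rewrite -abseM.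
have intP d (T : measurableType d) (mu : {measure set T -> \bar R}) (u : T ->
  R) :
    measurable_fun setT u ->
    (\int[mu]_x `|(u x)%:E| = +oo)%E \/ mu.-integrable setT (EFin \o u).
  move=> mu'; have [e|ne] := eqVneq (\int[mu]_x `|(u x)%:E|)%E +oo%E;
    [by left|right].
  by apply/integrableP; split; [exact/measurable_EFinP|rewrite ltey].
(* If one factor is not integrable, [tonelli] leaves only these two values, according to whether the
   other factor has integral of absolute value 0. *)
have oo_case : (\int[m1 \x m2]_z `|(h z)%:E| =
  +oo)%E \/ (\int[m1 \x m2]_z `|(h z)%:E| = 0)%E ->
    \int[(m1 \x m2)%E]_z h z = 0.
  case=> e.
    apply: Rintegral_nonintegrable => // /integrableP[_]; by rewrite e ltxx.
  have ih : (m1 \x m2)%E.-integrable setT (EFin \o h).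
    by apply/integrableP; split => //=; rewrite e ltry.
  apply/eqP; rewrite -normr_le0.
  apply: (le_trans (le_normr_Rintegral _ ih)) => //.
  by rewrite /Rintegral e.
rewrite -[LHS]/(\int[(m1 \x m2)%E]_z h z).
have nint d (T : measurableType d) (mu : {measure set T -> \bar R}) (u : T ->
  R) :
    measurable_fun setT u -> (\int[mu]_x `|(u x)%:E| = +oo)%E ->
      \int[mu]_x u x = 0.
  by move=> mu' e; apply: Rintegral_nonintegrable => // /integrableP[_];
    rewrite e ltxx.
have F0 : (0 <= \int[m1]_x `|(f x)%:E|)%E by exact: integral_ge0.
have G0 : (0 <= \int[m2]_x `|(g x)%:E|)%E by exact: integral_ge0.
have [fo|fi] := intP _ _ m1 _ mf.
  rewrite [X in _ = X * _]nint// mul0r; apply: oo_case; rewrite tonelli fo.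
  have [->|gN0] := eqVneq (\int[m2]_x `|(g x)%:E|)%E 0%E; first by right;
    rewrite mule0.
  by left; rewrite gt0_mulye// lt0e gN0.
have [go|gi] := intP _ _ m2 _ mg.
  rewrite [X in _ = _ * X]nint// mulr0; apply: oo_case; rewrite tonelli go.
  have [->|fN0] := eqVneq (\int[m1]_x `|(f x)%:E|)%E 0%E; first by right;
    rewrite mul0e.
  by left; rewrite gt0_muley// lt0e fN0.
have hi : (m1 \x m2)%E.-integrable setT (EFin \o h).
  apply/integrableP; split => //=; rewrite tonelli.
  case/integrableP: fi => _ fo; case/integrableP: gi => _ go.
  by apply: lte_mul_pinfty => //; rewrite ge0_fin_numE.
rewrite [LHS]/Rintegral -(integral12_prod_meas1 hi) /fubini_F /=.
under eq_integral do under eq_integral do rewrite /h/= EFinM.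
under eq_integral => x _.
  rewrite integralZl//.
  over.
have -> : (\int[m2]_y (g y)%:E)%E = (\int[m2]_y g y)%:E.
  by rewrite /Rintegral fineK//; exact: integrable_fin_num.
rewrite /= integralZr// fineM//; exact: integrable_fin_num.
Qed.

End Rintegral_product.

(** * Uniqueness of power measures and relabelling of coordinates *)

Section box_unique.
Context {R : realType} {d : measure_display} {T : measurableType d}.

Definition box n (A : 'I_n -> set T) : set (n.-tuple T) :=
  [set t | forall i, A i (tnth t i)].

Lemma measurable_box n (A : 'I_n -> set T) :
  (forall i, measurable (A i)) -> measurable (box A).
Proof.
move=> mA; rewrite (_ : box A = \bigcap_(i in [set: 'I_n])
    ((fun t => tnth t i) @^-1` A i)); last first.
  by apply/seteqP; split => t /= h i => [_|]; exact: h.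
apply: fin_bigcap_measurable => // i _.
by rewrite -[X in measurable X]setTI; exact: measurable_tnth.
Qed.

Definition boxes n : set (set (n.-tuple T)) :=
  [set B | exists2 A, (forall i, measurable (A i)) & B = @box n A].

Lemma measurable_boxesE n : @measurable _ (n.-tuple T) = <<s @boxes n >>.
Proof.
apply/seteqP; split.
  apply: smallest_sub; first exact: smallest_sigma_algebra.
  elim/big_rec: _ => [|i U _ UB]; first exact: sub0set.
  move=> B [[A mA <-]|/UB//]; apply: sub_sigma_algebra.
  exists (fun j => if j == i then A else setT).
    by move=> j; case: ifP.
  apply/seteqP; split => t /=.
    by move=> [_ At] j; case: eqP => // ->.
  by move=> /(_ i); rewrite eqxx.
apply: smallest_sub; first exact: sigma_algebra_measurable.
by move=> B [A mA ->]; exact: measurable_box.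
Qed.

Lemma setI_closed_boxes n : setI_closed (@boxes n).
Proof.
move=> _ _ [A mA ->] [B mB ->]; exists (fun i => A i `&` B i).
  by move=> i; exact: measurableI.
by apply/seteqP; split => t /=; [move=> [h1 h2] i; split|move=> h; split => i;
  have [] := h i].
Qed.

(** Boxes generate the sigma-algebra and are stable under intersection, and the boxes with all sides
    [F k] have finite measure and exhaust the space, so measures that agree on boxes are equal. *)
Lemma power_measure_unique n (mu : {sigma_finite_measure set T -> \bar R})
    (nu : {measure set (n.-tuple T) -> \bar R}) :
  (forall A : 'I_n -> set T, (forall i, measurable (A i)) ->
    nu (box A) = \prod_(i < n) mu (A i))%E ->
  forall B, measurable B -> nu B = power_measure mu n B.
Proof.
move=> nuE B mB; have /sigma_finiteP[F [UF ndF mF]] := sigma_finiteT mu.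
apply/esym.
apply: (measure_unique (@boxes n) (fun k => @box n (fun _ => F k))) => //.
- exact: measurable_boxesE.
- exact: setI_closed_boxes.
- by move=> k; exists (fun _ => F k) => // i; have [] := mF k.
- apply/seteqP; split => // t _.
  have tF i : exists k, F k (tnth t i).
    by have : [set: T] (tnth t i) by []; rewrite UF => -[k _ Fk]; exists k.
  have [f fP] := choice tF.
  (* As [F] is increasing, the largest index serves all coordinates. *)
  exists (\max_i f i)%N => // i.
  by have := fP i; apply/subsetPset/ndF/leq_bigmax.
- by move=> _ [A mA ->]; rewrite [LHS]power_measure_box//; apply/esym;
    exact: nuE.
- move=> k; rewrite [X in (X < _)%E]power_measure_box; last by move=> i;
    have [] := mF k.
  have [_ Fk] := mF k.
  suff : (\prod_(i < n) mu (F k))%E \is a fin_num by move=> h; rewrite ltey;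
    apply: contraTN h => /eqP ->.
  elim/big_ind: _ => // [x y|i _]; first exact: fin_numM.
  by rewrite ge0_fin_numE.
Qed.

Lemma power_measure_coord n (mu : {sigma_finite_measure set T ->
  \bar R}) (l : 'I_n) (p : T) :
  measurable [set p] -> mu [set p] = 0%E ->
  power_measure mu n [set z | tnth z l = p] = 0%E.
Proof.
move=> mp mup; rewrite (_ : [set z | _] =
  box (fun m => if m == l then [set p] else setT)).
  rewrite [LHS]power_measure_box; last by move=> m; case: ifP.
  by rewrite (bigD1 l)//= eqxx mup mul0e.
apply/seteqP; split => z /=; first by move=> <- m; case: eqP => // ->.
by move=> /(_ l); rewrite eqxx.
Qed.

End box_unique.

Section join.
Context {R : realType} {d : measure_display} {T : measurableType d}.
Variables (n a b : nat) (s : 'I_a -> 'I_n) (t : 'I_b -> 'I_n).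
Hypothesis st : vertex_split s t.
Let s_inj := split_injl st.
Let t_inj := split_injr st.
Let st_disj := split_disj st.
Let st_cover := split_cover st.
Variable r : 'I_n -> 'I_a + 'I_b.
Hypothesis rK : cancel (st_sum s t) r.

Definition join (z : a.-tuple T * b.-tuple T) : n.-tuple T :=
  [tuple match r m with inl k => tnth z.1 k | inr l => tnth z.2 l end | m < n].

Lemma joinl z k : tnth (join z) (s k) = tnth z.1 k.
Proof. by rewrite tnth_mktuple (rK (inl k)). Qed.

Lemma joinr z k : tnth (join z) (t k) = tnth z.2 k.
Proof. by rewrite tnth_mktuple (rK (inr k)). Qed.

Lemma measurable_join : measurable_fun setT join.
Proof.
apply/measurable_fun_tnthP => m.
rewrite (_ : _ \o _ =
    (fun z => match r m with inl k => tnth z.1 k | inr l => tnth z.2 l end));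
      last first.
  by apply/funext => z /=; rewrite tnth_mktuple.
case: (r m) => k; apply: (measurableT_comp (measurable_tnth k)) => //.
Qed.

Variable mu : {sigma_finite_measure set T -> \bar R}.

Local Notation pa := (power_measure mu a).
Local Notation pb := (power_measure mu b).

Lemma join_box (A : 'I_n -> set T) :
  join @^-1` box A = box (fun k => A (s k)) `*` box (fun k => A (t k)).
Proof.
apply/seteqP; split => -[z1 z2] /=.
  by move=> h; split => k /=; [have := h (s k); rewrite joinl|have := h (t k);
    rewrite joinr].
move=> [h1 h2] m; case: (st_cover m) => -[k ->]; rewrite ?joinl ?joinr;
  [exact: h1|exact: h2].
Qed.

(** The image of the product measure under [join] gives each box the product of the measures of its
    sides, so it is the power measure. *)
Lemma ge0_integral_join (f : n.-tuple T -> \bar R) :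
  measurable_fun setT f -> (forall z, 0 <= f z)%E ->
  (\int[power_measure mu n]_z f z = \int[pa \x pb]_z f (join z))%E.
Proof.
move=> mf f0.
rewrite -[RHS](ge0_integral_pushforward measurable_join (pa \x pb)%E
  measurableT mf)//.
apply: eq_measure_integral => [|mj B mB _]; first exact: measurable_join.
apply: esym; apply: power_measure_unique => // A mA.
transitivity ((pa \x pb)%E (join @^-1` box A)); first by [].
rewrite join_box product_measure1E; last 2 first.
- by apply: measurable_box.
- by apply: measurable_box.
rewrite [X in (X * _)%E]power_measure_box// [X in (_ * X)%E]power_measure_box//.
by rewrite (big_glue st).
Qed.

Lemma Rintegral_join (f : n.-tuple T -> R) : measurable_fun setT f ->
  \int[power_measure mu n]_z f z = \int[(pa \x pb)%E]_z f (join z).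
Proof.
move=> mf; have mEf : measurable_fun setT (EFin \o f) by exact/measurable_EFinP.
rewrite /Rintegral integralE [in RHS]integralE; congr (fine (_ - _)%E).
  apply: etrans (ge0_integral_join (measurable_funepos mEf) (fun z =>
    funepos_ge0 _ z)) _.
  by apply: eq_integral => z _; rewrite !funeposE.
apply: etrans (ge0_integral_join (measurable_funeneg mEf) (fun z => funeneg_ge0
  _ z)) _.
by apply: eq_integral => z _; rewrite !funenegE.
Qed.

End join.

Section point_null.
Context {R : realType}.
Local Notation plane := (2.-tuple (measurableTypeR R)).
Local Notation lambda2 := (power_measure (@lebesgue_measure R) 2).

Lemma measurable_set1_plane (p : plane) : measurable [set p].
Proof.
rewrite (_ : [set p] = @box _ (measurableTypeR R) 2 (fun c => [set tnth p c])).
  by apply: measurable_box => c; exact: measurable_set1.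
apply/seteqP; split => q; first by move=> ->.
by move=> h; exact: eq_from_tnth.
Qed.

Lemma plane_set1 (p : plane) : lambda2 [set p] = 0%E.
Proof.
rewrite (_ : [set p] = @box _ (measurableTypeR R) 2 (fun c => [set tnth p c])).
  rewrite [LHS]power_measure_box; last by move=> c; exact: measurable_set1.
  by rewrite big_ord_recl [X in (X * _)%E]lebesgue_measure_set1 mul0e.
apply/seteqP; split => q; first by move=> ->.
by move=> h; exact: eq_from_tnth.
Qed.

Lemma measurable_coord_eq n d (X : measurableType d) (u v : X ->
  n.-tuple (measurableTypeR R)) :
  measurable_fun setT u -> measurable_fun setT v ->
    measurable [set x | u x = v x].
Proof.
move=> mu mv; rewrite (_ : [set x | _] = \bigcap_(i in [set: 'I_n])
    [set x | tnth (u x) i == tnth (v x) i]); last first.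
  apply/seteqP; split => x /=; first by move=> e i _ /=; rewrite e.
  by move=> h; apply: eq_from_tnth => i; exact/eqP/h.
apply: fin_bigcap_measurable => // i _.
rewrite -[X in measurable X]setTI;
  apply: (measurable_fun_eqr _ _ measurableT (Y := [set true])) => //.
- by apply: (measurableT_comp (measurable_tnth i)).
- by apply: (measurableT_comp (measurable_tnth i)).
Qed.

(** For a fixed first part, a collision confines one point of the second part to a single point of
    the plane, which is null; integrating over the first part and ranging over the finitely many
    pairs [(k, l)] concludes. *)
Lemma ae_no_collision a b :
  {ae (power_measure lambda2 a \x power_measure lambda2 b)%E,
    forall z k l, tnth z.2 l <> tnth z.1 k}.
Proof.
apply: filter_forall => k; apply: filter_forall => l.
exists [set z | tnth z.2 l = tnth z.1 k]; split.
- apply: measurable_coord_eq.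
    by apply: (measurableT_comp (measurable_tnth l)).
  by apply: (measurableT_comp (measurable_tnth k)).
- rewrite /product_measure1; apply: integral0_eq => z1 _ /=.
  rewrite -[RHS](power_measure_coord l (measurable_set1_plane (tnth z1 k))
    (plane_set1 _)); congr (power_measure _ _ _).
  by apply/seteqP; split => z2; rewrite /xsection/= inE.
- by move=> z /= /contrapT.
Qed.

End point_null.

(** * Derivatives of angles *)

Section local_argument.
Context {R : realType}.
Implicit Types (x y r rho theta : R).

Lemma is_arg_polar x y theta : is_arg (Complex x y) theta ->
  exists2 rho, 0 < rho & x = rho * cos theta /\ y = rho * sin theta.
Proof.
move=> [w0]; set w := Complex x y in w0 *.
have : 0 < `|w| by rewrite normr_gt0.
rewrite normc_def => /[swap]; set rho := Num.sqrt _ => e.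
rewrite ltcR => rho0; exists rho => //.
by move: e => [-> ->]; rewrite !mul0r subr0 addr0.
Qed.

Lemma polar_is_arg rho theta : 0 < rho ->
  is_arg (Complex (rho * cos theta) (rho * sin theta)) theta.
Proof.
move=> rho0.
have n : `|Complex (rho * cos theta) (rho * sin theta)| = rho%:C%C.
  rewrite normc_def/= !exprMn -mulrDr cos2Dsin2 mulr1 sqrtr_sqr gtr0_norm//.
split; first by rewrite -normr_gt0 n ltcR.
by rewrite n; apply/eqP; rewrite eq_complex/= !mul0r subr0 addr0 !eqxx.
Qed.

Lemma polar_exists x y : (x, y) != (0, 0) ->
  exists rho theta, [/\ 0 < rho, x = rho * cos theta & y = rho * sin theta].
Proof.
move=> xy0.
have N0 : 0 < x ^+ 2 + y ^+ 2.
  rewrite lt0r addr_ge0 ?sqr_ge0// andbT paddr_eq0 ?sqr_ge0// !sqrf_eq0.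
  by apply: contraNN xy0 => /andP[/eqP -> /eqP ->].
pose rho := Num.sqrt (x ^+ 2 + y ^+ 2).
have rho0 : 0 < rho by rewrite sqrtr_gt0.
have rho2 : rho ^+ 2 = x ^+ 2 + y ^+ 2 by rewrite sqr_sqrtr// ltW.
have xr : -1 <= x / rho <= 1.
  rewrite -ler_norml normrM normfV (gtr0_norm rho0) ler_pdivrMr// mul1r.
  by rewrite -sqrtr_sqr ler_wsqrtr// lerDl sqr_ge0.
have sE : sin (acos (x / rho)) = `|y| / rho.
  rewrite sin_acos// (_ : 1 - _ = (y / rho) ^+ 2).
    by rewrite sqrtr_sqr normrM normfV (gtr0_norm rho0).
  by rewrite !exprMn !exprVn rho2; field; rewrite gt_eqF.
exists rho.
have [y0|y0] := leP 0 y.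
  exists (acos (x / rho)); split => //;
    first by rewrite acosK ?in_itv//= mulrC divfK// gt_eqF.
  by rewrite sE ger0_norm// mulrC divfK// gt_eqF.
exists (- acos (x / rho)); split => //.
  by rewrite cosN acosK ?in_itv//= mulrC divfK// gt_eqF.
by rewrite sinN sE ltr0_norm// mulNr opprK mulrC divfK// gt_eqF.
Qed.

Variables (u v : R -> R) (a b : R).
Hypotheses (du : is_derive (0 : R) (1 : R) u a) (dv : is_derive (0 : R) (1 : R)
  v b).
Hypothesis uv0 : (u 0, v 0) != (0, 0).

Let N := u 0 ^+ 2 + v 0 ^+ 2.
(** The classical [d arg = (u dv - v du) / (u^2 + v^2)] at 0. *)
Let c0 := (u 0 * b - v 0 * a) / N.

Let N_gt0 : 0 < N.
Proof.
rewrite /N lt0r addr_ge0 ?sqr_ge0// andbT paddr_eq0 ?sqr_ge0// !sqrf_eq0.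
by apply: contraNN uv0 => /andP[/eqP -> /eqP ->].
Qed.

(** Any determination satisfies [u sin theta = v cos theta] near 0; differentiating gives a linear
    equation for [c], solved with the polar form of [(u 0, v 0)]. *)
Lemma arg_derive_unique (theta : R -> R) c :
  (\forall t \near (0 : R), is_arg (Complex (u t) (v t)) (theta t)) ->
  is_derive (0 : R) (1 : R) theta c -> c = c0.
Proof.
move=> uvtheta dtheta.
have [rho rho0 [u0 v0]] := is_arg_polar (nbhs_singleton uvtheta).
pose D (t : R) := u t * sin (theta t) - v t * cos (theta t).
have D0 : \forall t \near (0 : R), cst 0 t = D t.
  near=> t; have /is_arg_polar[rt _ [ut vt]]
    : is_arg (Complex (u t) (v t)) (theta t) by near: t.
  by rewrite /D ut vt /=; ring.
have dsin : is_derive (0 : R) (1 : R) (sin \o theta) (cos (theta 0) * c).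
  exact: is_derive1_comp.
have dcos : is_derive (0 : R) (1 : R) (cos \o theta) (- sin (theta 0) * c).
  exact: is_derive1_comp.
have dD : is_derive (0 : R) (1 : R) D
    ((u 0 *: (cos (theta 0) * c) + sin (theta 0) *: a) -
     (v 0 *: (- sin (theta 0) * c) + cos (theta 0) *: b)).
  by apply: is_deriveB; apply: is_deriveM.
have : 'D_1 D 0 = 'D_1 (cst 0) (0 : R).
  by apply: near_eq_derive; apply: filterS D0 => t <-.
rewrite derive_cst (@derive_val _ _ _ _ _ _ _ dD) => e.
rewrite /c0; apply/eqP; rewrite eq_sym -subr_eq0; apply/eqP.
have {}e : u 0 * (c * cos (theta 0)) + sin (theta 0) * a +
    v 0 * (c * sin (theta 0)) - cos (theta 0) * b = 0.
  by rewrite -[RHS]e /GRing.scale/=; ring.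
apply: (mulIf (lt0r_neq0 N_gt0)); rewrite mul0r mulrBl divfK ?gt_eqF//.
transitivity (- rho * (u 0 * (c * cos (theta 0)) + sin (theta 0) * a +
    v 0 * (c * sin (theta 0)) - cos (theta 0) * b)); last by rewrite e mulr0.
by rewrite /N u0 v0; ring.
Unshelve. all: by end_near. Qed.

(** [A] and [B] are the real and imaginary parts of [u + i v] times the conjugate of its value at 0.
    This product starts at [N > 0], so near 0 the arctangent of [B / A] is an argument of it; adding
    [theta0] undoes the rotation. *)
Lemma arg_derive_exists : exists theta : R -> R,
  (\forall t \near (0 : R), is_arg (Complex (u t) (v t)) (theta t)) /\
  is_derive (0 : R) (1 : R) theta c0.
Proof.
have [rho [theta0 [rho0 u0 v0]]] := polar_exists uv0.
pose A (t : R) := u 0 * u t + v 0 * v t.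
pose B (t : R) := u 0 * v t - v 0 * u t.
have dA : is_derive (0 : R) (1 : R) A (u 0 * a + v 0 * b).
  by apply: is_deriveD; apply: is_deriveZ.
have dB : is_derive (0 : R) (1 : R) B (u 0 * b - v 0 * a).
  by apply: is_deriveB; apply: is_deriveZ.
have A0 : A 0 = N by rewrite /A /N !expr2.
have B0 : B 0 = 0 by rewrite /B mulrC subrr.
have An0 : A 0 != 0 by rewrite A0 gt_eqF.
exists (fun t => theta0 + atan (B t / A t)); split.
  have cA : {for 0, continuous A}.
    by apply: differentiable_continuous; apply/derivable1_diffP; have [] := dA.
  near=> t.
  have At : 0 < A t.
    near: t; have /cvgr_gt : A t @[t --> (0 : R)] --> A 0 by exact: cA.
    by apply; rewrite A0.
  set phi := atan (B t / A t).
  have cphi : 0 < cos phi by apply: cos_gt0_pihalf;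
    rewrite atan_gtNpi2 atan_ltpi2.
  have sphi : sin phi = B t / A t * cos phi.
    by rewrite -[B t / A t](atanK) -/phi /tan divfK// gt_eqF.
  (* The modulus of [u + i v]: [A t / cos phi] is that of the rotated number, and [rho / N] removes
     the factor [rho], as [N] is the square of [rho]. *)
  pose k := A t / cos phi * (rho / N).
  have k0 : 0 < k by rewrite !mulr_gt0// ?invr_gt0.
  have -> : u t = k * cos (theta0 + phi).
    rewrite cosD sphi /k.
    have -> : u t = (A t * u 0 - B t * v 0) / N by rewrite /A /B /N; field;
      rewrite gt_eqF.
    by rewrite u0 v0; field; rewrite !gt_eqF.
  have -> : v t = k * sin (theta0 + phi).
    rewrite sinD sphi /k.
    have -> : v t = (A t * v 0 + B t * u 0) / N by rewrite /A /B /N; field;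
      rewrite gt_eqF.
    by rewrite u0 v0; field; rewrite !gt_eqF.
  exact: polar_is_arg.
have dAV : is_derive (0 : R) (1 : R) (fun t => (A t)^-1) (- (A 0) ^- 2 *: (u 0
  * a + v 0 * b)).
  exact: is_deriveV.
have dBA : is_derive (0 : R) (1 : R) (fun t => B t / A t) c0.
  have -> : c0 = B 0 *: (- (A 0) ^- 2 *: (u 0 * a + v 0 * b)) + (A 0)^-1 *: (u
    0 * b - v 0 * a).
    by rewrite B0 scale0r add0r A0 /c0 mulrC.
  exact: is_deriveM.
have datan : is_derive (0 : R) (1 : R) (atan \o (fun t => B t / A t)) ((1 + (B
  0 / A 0) ^+ 2)^-1 * c0).
  apply: is_derive1_comp.
rewrite B0 mul0r expr0n addr0 invr1 mul1r in datan.
have -> : c0 = 0 + c0 by rewrite add0r.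
by apply: is_deriveD.
Unshelve. all: by end_near. Qed.

Lemma dargE (w : R -> R[i]) (r : R -> R) :
  (\forall t \near (0 : R), 0 < r t /\ w t = Complex (r t * u t) (r t * v t)) ->
  darg w = (u 0 * b - v 0 * a) / (u 0 ^+ 2 + v 0 ^+ 2).
Proof.
move=> wr; rewrite -[RHS]/c0.
have argE (theta : R ->
  R) : (\forall t \near (0 : R), is_arg (w t) (theta t)) <->
    (\forall t \near (0 : R), is_arg (Complex (u t) (v t)) (theta t)).
  split; apply: filter_app; near=> t.
    have [rt ->] : 0 < r t /\ w t = Complex (r t * u t) (r t * v t) by near: t.
    move=> /is_arg_polar[rho rho0 [e1 e2]].
    have -> : u t = (rho / r t) * cos (theta t).
      by apply: (mulfI (lt0r_neq0 rt)); rewrite e1; field; rewrite gt_eqF.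
    have -> : v t = (rho / r t) * sin (theta t).
      by apply: (mulfI (lt0r_neq0 rt)); rewrite e2; field; rewrite gt_eqF.
    by apply: polar_is_arg; rewrite divr_gt0.
  have [rt ->] : 0 < r t /\ w t = Complex (r t * u t) (r t * v t) by near: t.
  move=> /is_arg_polar[rho rho0 [-> ->]]; rewrite !mulrA.
  by apply: polar_is_arg; rewrite mulr_gt0.
(* Uniqueness identifies the value that [get] picks; existence excludes its default. *)
rewrite /darg; case: xgetP => [c _ [theta [/argE h dth]]|H].
  exact: arg_derive_unique h dth.
have [theta [h dth]] := arg_derive_exists.
by case: (H c0); exists theta; split => //; exact/argE.
Unshelve. all: by end_near. Qed.

End local_argument.

(* (q - p) (conj q - p) has the same argument as (q - p) / (q - conj p), and its
   real and imaginary parts hyp_re and hyp_im are polynomials in coordinates;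
   dhyp_re and dhyp_im are their derivatives along the velocities dp and dq. *)
Section hyp_angle.
Context {R : realType}.
Implicit Types p q dp dq : R * R.

Definition hyp_re p q : R := (q.1 - p.1) ^+ 2 + q.2 ^+ 2 - p.2 ^+ 2.
Definition hyp_im p q : R := - (2 * p.2 * (q.1 - p.1)).
Definition dhyp_re p q dp dq : R :=
  2 * (q.1 - p.1) * (dq.1 - dp.1) + 2 * q.2 * dq.2 - 2 * p.2 * dp.2.
Definition dhyp_im p q dp dq : R :=
  - (2 * dp.2 * (q.1 - p.1) + 2 * p.2 * (dq.1 - dp.1)).

Definition dhyp_angle p q dp dq : R :=
  (hyp_re p q * dhyp_im p q dp dq - hyp_im p q * dhyp_re p q dp dq) /
  (hyp_re p q ^+ 2 + hyp_im p q ^+ 2).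

Definition move p dp (t : R) : R * R := (p.1 + dp.1 * t, p.2 + dp.2 * t).

Lemma is_derive_poly2 (f : R -> R) (c0 c1 c2 : R) :
  (forall t, f t = c0 + c1 * t + c2 * t ^+ 2) -> is_derive (0 : R) (1 : R) f c1.
Proof.
move=> fE; have -> : f = (cst c0 + c1 \*: id) + (c2 \*: (id : R -> R) ^+ 2).
  apply/funext => t; rewrite fE.
  by rewrite -[RHS]/(c0 + c1 * t + c2 * (((id : R -> R) ^+ 2) t)) exprfctE.
apply: is_derive_eq.
by rewrite add0r expr1 mulr0 scale0r scaler0 addr0 [_ *: _]mulr1.
Qed.

Lemma hyp_ratioE p q : 0 < q.2 + p.2 ->
  let r := ((q.1 - p.1) ^+ 2 + (q.2 + p.2) ^+ 2)^-1 in
  hyp_ratio (Complex p.1 p.2) (Complex q.1 q.2) =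
  Complex (r * hyp_re p q) (r * hyp_im p q).
Proof.
move=> pq r; have n0 : 0 < (q.1 - p.1) ^+ 2 + (q.2 + p.2) ^+ 2.
  by rewrite ltr_wpDl ?sqr_ge0// exprn_gt0.
rewrite /hyp_ratio; set D := (X in _ / X).
have DE : D = Complex (q.1 - p.1) (q.2 + p.2).
  by rewrite /D /=; apply/eqP; rewrite eq_complex/= opprK !eqxx.
have D0 : D != 0.
  by rewrite DE eq_complex/=; apply/negP => /andP[_ /eqP e]; move: pq;
    rewrite e ltxx.
apply: (mulIf D0); rewrite divfK// DE; apply/eqP;
  rewrite eq_complex/= /r /hyp_re /hyp_im.
by apply/andP; split; apply/eqP; field; rewrite gt_eqF.
Qed.

Lemma darg_hyp p q dp dq : 0 < p.2 -> 0 <= q.2 -> p != q ->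
  darg (fun t => hyp_ratio (Complex (move p dp t).1 (move p dp t).2)
                           (Complex (move q dq t).1 (move q dq t).2)) =
  dhyp_angle p q dp dq.
Proof.
move=> p2 q2 pq.
pose u t := hyp_re (move p dp t) (move q dq t).
pose v t := hyp_im (move p dp t) (move q dq t).
have m0 x dx : move x dx 0 = x by rewrite /move !mulr0 !addr0; case: x.
have u0 : u 0 = hyp_re p q by rewrite /u !m0.
have v0 : v 0 = hyp_im p q by rewrite /v !m0.
have du : is_derive (0 : R) (1 : R) u (dhyp_re p q dp dq).
  apply: (@is_derive_poly2 _ (hyp_re p q) _
    ((dq.1 - dp.1) ^+ 2 + dq.2 ^+ 2 - dp.2 ^+ 2)) => t.
  by rewrite /u /hyp_re /dhyp_re /=; ring.
have dv : is_derive (0 : R) (1 : R) v (dhyp_im p q dp dq).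
  apply: (@is_derive_poly2 _ (hyp_im p q) _ (- (2 * dp.2 * (dq.1 - dp.1)))) =>
    t.
  by rewrite /v /hyp_im /dhyp_im /=; ring.
(* The squared modulus of [(q - p) (conj q - p)]: the first factor is nonzero because [p] and [q]
   differ, the second because [p] lies in the open and [q] in the closed upper half plane. *)
have sq0 : u 0 ^+ 2 + v 0 ^+ 2 =
    ((q.1 - p.1) ^+ 2 + (q.2 - p.2) ^+ 2) * ((q.1 - p.1) ^+ 2 + (q.2 + p.2) ^+
      2).
  by rewrite u0 v0 /hyp_re /hyp_im; ring.
have uv0 : (u 0, v 0) != (0, 0).
  apply: contraNneq pq => -[u00 v00]; move: sq0;
    rewrite u00 v00 expr0n addr0 => /esym/eqP.
  rewrite mulf_eq0 => /orP[];
    rewrite paddr_eq0 ?sqr_ge0// !sqrf_eq0 => /andP[/eqP e1 /eqP e2].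
    apply/eqP; apply: esym;
      rewrite [LHS]surjective_pairing [RHS]surjective_pairing.
    by rewrite (subr0_eq e1) (subr0_eq e2).
  by move: p2 q2 e2; lra.
rewrite /dhyp_angle -u0 -v0.
apply: (dargE du dv uv0
  (r := fun t => (((move q dq t).1 - (move p dp t).1) ^+ 2 + ((move q dq t).2 +
    (move p dp t).2) ^+ 2)^-1)).
have pos : \forall t \near (0 : R), 0 < (move q dq t).2 + (move p dp t).2.
  have d2 : is_derive (0 : R) (1 : R) (fun t => (move q dq t).2 + (move p dp
    t).2) (dq.2 + dp.2).
    by apply: (@is_derive_poly2 _ (q.2 + p.2) _ 0) => t /=; ring.
  have c2 : {for 0, continuous (fun t => (move q dq t).2 + (move p dp t).2)}.
    by apply: differentiable_continuous; apply/derivable1_diffP; have [] := d2.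
  by apply: (cvgr_gt _ c2); rewrite /= !mulr0 !addr0; lra.
near=> t; have pt : 0 < (move q dq t).2 + (move p dp t).2 by near: t.
split; last exact: hyp_ratioE.
by rewrite invr_gt0 ltr_wpDl ?sqr_ge0// exprn_gt0.
Unshelve. all: by end_near. Qed.

End hyp_angle.

(** * Weights *)

Section finite_det.
Variable A : comPzRingType.

(** The same permutation acts on rows and columns, so its sign occurs twice. *)
Lemma det_reindex m n (g : 'I_m -> 'I_n) (M : 'M[A]_n) : bijective g ->
  \det (\matrix_(i, j) M (g i) (g j)) = \det M.
Proof.
move=> gbij; have mn : m = n by have := bij_eq_card gbij; rewrite !card_ord.
case: n / mn g M gbij => g M gbij; have g_inj := bij_inj gbij.
pose s := perm g_inj.
have -> : \matrix_(i, j) M (g i) (g j) = row_perm s (col_perm s M).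
  by apply/matrixP => i j; rewrite !mxE !permE.
rewrite row_permE col_permE !det_mulmx !det_perm odd_permV.
by rewrite mulrCA -expr2 sqrr_sign mulr1.
Qed.

Definition fdet (T : finType) (F : T -> T -> A) : A :=
  \det (\matrix_(r < #|T|, c < #|T|) F (enum_val r) (enum_val c)).

Lemma fdet_block (T T1 T2 : finType) (h : T1 + T2 -> T) (F : T -> T -> A) :
  bijective h -> (forall x y, F (h (inl x)) (h (inr y)) = 0) ->
  fdet F = fdet (fun x y => F (h (inl x)) (h (inl y))) *
           fdet (fun x y => F (h (inr x)) (h (inr y))).
Proof.
move=> hbij F0.
pose g0 (i : 'I_(#|T1| + #|T2|)) : T1 + T2 :=
  match fintype.split i with inl a => inl (enum_val a) | inr b => inr (enum_val
    b) end.
pose g0' (x : T1 + T2) : 'I_(#|T1| + #|T2|) :=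
  match x with inl a => lshift _ (enum_rank a) | inr b => rshift _ (enum_rank
    b) end.
have g0bij : bijective g0.
  exists g0'.
    by move=> i; rewrite /g0; case: (split_ordP i) => j ->;
      rewrite /= enum_valK.
  move=> [x|x]; rewrite /g0 /g0'.
    by rewrite (unsplitK (inl _)) enum_rankK.
  by rewrite (unsplitK (inr _)) enum_rankK.
pose g i : 'I_#|T| := enum_rank (h (g0 i)).
have gbij : bijective g.
  by apply: bij_comp; [exact: enum_rank_bij|exact: bij_comp].
rewrite {1}/fdet -(det_reindex _ gbij) -(det_lblock _
  (\matrix_(r, c) F (h (inr (enum_val r))) (h (inl (enum_val c))))).
congr (\det _); apply/matrixP => i j.
case: (split_ordP i) => k ->; case: (split_ordP j) => l ->.
- by rewrite block_mxEul !mxE !enum_rankK /g0 !(unsplitK (inl _)).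
- by rewrite block_mxEur !mxE !enum_rankK /g0 (unsplitK (inl _)) (unsplitK (inr
    _)).
- by rewrite block_mxEdl !mxE !enum_rankK /g0 (unsplitK (inl _)) (unsplitK (inr
    _)).
- by rewrite block_mxEdr !mxE !enum_rankK /g0 !(unsplitK (inr _)).
Qed.

End finite_det.

Section jacobian.
Context {R : realType}.
Local Notation plane := (2.-tuple (measurableTypeR R)).
Local Notation config n := (n.-tuple plane).

Definition coords n (z : config n) (v : vertex n) : R * R :=
  match v with
  | inl k => (tnth (tnth z k) ord0, tnth (tnth z k) ord_max)
  | inr i => ((i : nat)%:R, 0)
  end.

(** How [v] moves when the coordinate [kc] moves at unit speed; only one vertex has nonzero
    velocity. *)
Definition velocity n (kc : 'I_n * 'I_2) (v : vertex n) : R * R :=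
  (((v == inl kc.1) && (kc.2 == ord0))%:R,
    ((v == inl kc.1) && (kc.2 == ord_max))%:R).

Lemma positionE n (z : config n) v : position z v =
  Complex (coords z v).1 (coords z v).2.
Proof.
case: v => [k|i] //=; case: (ord2P i) => -> //=.
Qed.

Lemma coords_translate n (z : config n) kc t v :
  coords (translate z kc t) v = move (coords z v) (velocity kc v) t.
Proof.
case: v => [k|i]; last by rewrite /move /= !mul0r !addr0.
case: kc => k' c; rewrite /move /velocity /= !tnth_mktuple !xpair_eqE
  !mulr_natl.
by rewrite !(eq_sym c).
Qed.

(** The value of [dpsi] on the domain of integration, extended by the same formula to all
    configurations, where it stays measurable. *)
Definition jac n (G : kgraph n) (z : config n) (e : edge n) (kc : 'I_n * 'I_2)
  : R :=
  dhyp_angle (coords z (inl e.1)) (coords z (G e)) (velocity kc (inl e.1))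
    (velocity kc (G e)).

Definition conf_dom n : set (config n) := @half_spaces R n `\` @diagonals R n.

Lemma conf_domP n (z : config n) : conf_dom z <->
  (forall k, 0 < tnth (tnth z k) ord_max) /\ (forall k l, k != l ->
    tnth z k <> tnth z l).
Proof.
split=> [[h d]|[h d]].
  split => // k l kl e; apply: d; split => //; by exists k, l.
by split => // -[_ [k [l [kl e]]]]; exact: d kl e.
Qed.

(** [darg_hyp] asks for distinct endpoints: two aerial ends differ because no edge returns to its
    source and no points collide, an aerial and a ground end because only the former has positive
    imaginary part. *)
Lemma dpsiE n (G : kgraph n) e kc z : conf_dom z ->
  dpsi G e kc z = jac G z e kc.
Proof.
move=> /conf_domP[h d]; rewrite /dpsi.
rewrite (_ : (fun t : R => _) = (fun t => hyp_ratio
    (Complex (move (coords z (inl e.1)) (velocity kc (inl e.1)) t).1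
             (move (coords z (inl e.1)) (velocity kc (inl e.1)) t).2)
    (Complex (move (coords z (G e)) (velocity kc (G e)) t).1
             (move (coords z (G e)) (velocity kc (G e)) t).2))); last first.
  by apply/funext => t; cbv zeta; rewrite !positionE !coords_translate.
apply: darg_hyp => /=; first exact: h.
  by case: (G e) => [k|i] //=; exact/ltW/h.
have := (kgraphP G e.1).1 e.2; rewrite -surjective_pairing.
case: (G e) => [l|i] /=.
  move=> lk; apply/eqP => -[e0 e1]; apply: (d e.1 l).
    by apply/eqP => el; apply: lk; rewrite el.
  by apply: eq_from_tnth => c; case: (ord2P c) => ->.
by move=> _; apply/eqP => -[_ e0]; have := h e.1; rewrite e0 ltxx.
Qed.

Lemma weight_fdet n (G : kgraph n) : weight G = ((2 * pi) ^+ (2 * n))^-1 *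
  \int[@config_measure R n]_(z in @conf_dom n) fdet (jac G z).
Proof.
rewrite /weight; congr (_ * _); apply: eq_Rintegral => z; rewrite inE => zX.
by rewrite /angle_jacobian /fdet; congr (\det _); apply/matrixP => r c;
  rewrite !mxE dpsiE.
Qed.

Lemma measurable_coord n (k : 'I_n) (c : 'I_2) :
  measurable_fun setT (fun z : config n => tnth (tnth z k) c).
Proof. by apply: (measurableT_comp (measurable_tnth c));
  exact: measurable_tnth. Qed.

Lemma measurable_inv_fun : measurable_fun setT (fun x : R => x^-1).
Proof.
have -> : [set: R] = [set 0] `|` ~` [set 0] by rewrite setUv.
apply/measurable_funU => //; first exact: measurableC.
split; first exact: measurable_fun_set1.
apply: open_continuous_measurable_fun.
  by rewrite openC; exact: closed_eq.
by move=> x; rewrite inE /= => /eqP x0; exact: inv_continuous.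
Qed.

Lemma measurable_coords1 n (v : vertex n) :
  measurable_fun setT (fun z : config n => (coords z v).1).
Proof. by case: v => [k|i] /=;
  [exact: measurable_coord|exact: measurable_cst]. Qed.

Lemma measurable_coords2 n (v : vertex n) :
  measurable_fun setT (fun z : config n => (coords z v).2).
Proof. by case: v => [k|i] /=;
  [exact: measurable_coord|exact: measurable_cst]. Qed.

Lemma measurable_jac n (G : kgraph n) e kc :
  measurable_fun setT (fun z : config n => jac G z e kc).
Proof.
have p1 := measurable_coords1 (inl e.1 : vertex n).
have p2 := measurable_coords2 (inl e.1 : vertex n).
have q1 := measurable_coords1 (G e); have q2 := measurable_coords2 (G e).
have re : measurable_fun setT (fun z : config n => hyp_re (coords z (inl e.1))
  (coords z (G e))).
  rewrite /hyp_re; apply: measurable_funB; last by apply: measurable_funX.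
  apply: measurable_funD; last by apply: measurable_funX.
  by apply: measurable_funX; apply: measurable_funB.
have im : measurable_fun setT (fun z : config n => hyp_im (coords z (inl e.1))
  (coords z (G e))).
  rewrite /hyp_im; apply: measurable_funN; apply: measurable_funM.
    by apply: measurable_funM => //; exact: measurable_cst.
  by apply: measurable_funB.
rewrite /jac /dhyp_angle; apply: measurable_funM.
  apply: measurable_funB; apply: measurable_funM => //.
    rewrite /dhyp_im; apply: measurable_funN; apply: measurable_funD;
      apply: measurable_funM => //.
    + by apply: measurable_funB.
    + by apply: measurable_funM.
  rewrite /dhyp_re; apply: measurable_funB;
    last by do 2 apply: measurable_funM => //.
  apply: measurable_funD; last by do 2 apply: measurable_funM => //.
  by do 2 apply: measurable_funM => //; apply: measurable_funB.
by apply: (measurableT_comp measurable_inv_fun); apply: measurable_funD;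
  apply: measurable_funX.
Qed.

Lemma measurable_fdet_jac n (G : kgraph n) :
  measurable_fun setT (fun z : config n => fdet (jac G z)).
Proof.
rewrite /fdet /determinant; apply: measurable_sum => s;
  apply: measurable_funM => //.
by apply: measurable_prod => i _; under eq_fun do rewrite mxE;
  exact: measurable_jac.
Qed.

Lemma measurable_conf_dom n : measurable (@conf_dom n).
Proof.
have -> : @conf_dom n =
    (\bigcap_(k in [set: 'I_n]) ((fun z => tnth (tnth z k) ord_max) @^-1` `]0,
      +oo[)) `&`
    (\bigcap_(k in [set: 'I_n]) \bigcap_(l in [set: 'I_n])
      if k != l then ~` [set z | tnth z k = tnth z l] else setT).
  apply/seteqP; split => z.
    move=> /conf_domP[h d]; split.
      by move=> k _ /=; rewrite in_itv/= andbT.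
    by move=> k _ l _; case: ifP => // kl; exact: d.
  move=> [h d]; apply/conf_domP; split => [k|k l kl].
    by have := h k I; rewrite /= in_itv/= andbT.
  by have := d k I l I; rewrite kl.
apply: measurableI.
  apply: fin_bigcap_measurable => // k _; rewrite -[X in measurable X]setTI.
  exact: measurable_coord.
apply: fin_bigcap_measurable => // k _; apply: fin_bigcap_measurable => // l _.
case: ifP => // _; apply: measurableC.
by apply: measurable_coord_eq; exact: measurable_tnth.
Qed.

End jacobian.

Section weight_product.
Context {R : realType}.
Local Notation plane := (2.-tuple (measurableTypeR R)).
Local Notation config n := (n.-tuple plane).
Variables (n a b : nat) (s : 'I_a -> 'I_n) (t : 'I_b -> 'I_n).
Hypothesis st : vertex_split s t.
Let s_inj := split_injl st.
Let t_inj := split_injr st.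
Let st_disj := split_disj st.
Let st_cover := split_cover st.
Variable r : 'I_n -> 'I_a + 'I_b.
Hypothesis rK : cancel (st_sum s t) r.
Variables (G : kgraph n) (G1 : kgraph a) (G2 : kgraph b).
Hypothesis gl : is_gluing s t G G1 G2.

Let J (z : config a * config b) : config n := join r z.

Let coords_joinl z v : coords (J z) (vmap s v) = coords z.1 v.
Proof. by case: v => [k|i] //=; rewrite (joinl rK). Qed.

Let coords_joinr z v : coords (J z) (vmap t v) = coords z.2 v.
Proof. by case: v => [k|i] //=; rewrite (joinr rK). Qed.

Let se (e : edge a) : edge n := (s e.1, e.2).
Let te (e : edge b) : edge n := (t e.1, e.2).

Let velocity_s kc v : velocity (se kc) (vmap s v) = velocity kc v :> R * R.
Proof. by rewrite /velocity /= (inj_eq (vmap_inj s_inj) v (inl kc.1)). Qed.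

Let velocity_t kc v : velocity (te kc) (vmap t v) = velocity kc v :> R * R.
Proof. by rewrite /velocity /= (inj_eq (vmap_inj t_inj) v (inl kc.1)). Qed.

Let velocity_st kc v : velocity (te kc) (vmap s v) = (0, 0) :> R * R.
Proof.
rewrite /velocity /=; case: v => [k|i] //=.
by rewrite -[inl (s k) == _]/(s k == t kc.1) (negbTE (st_disj _ _)).
Qed.

Let jac_joinl z e kc : jac G (J z) (se e) (se kc) = jac G1 z.1 e kc.
Proof.
rewrite /jac gl.1 -surjective_pairing -[inl (s e.1)]/(vmap s (inl e.1)).
by rewrite !coords_joinl !velocity_s.
Qed.

Let jac_joinr z e kc : jac G (J z) (te e) (te kc) = jac G2 z.2 e kc.
Proof.
rewrite /jac gl.2 -surjective_pairing -[inl (t e.1)]/(vmap t (inl e.1)).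
by rewrite !coords_joinr !velocity_t.
Qed.

(** Moving a vertex of the second part moves neither end of an edge of the first. *)
Let jac_join0 z e kc : jac G (J z) (se e) (te kc) = 0.
Proof.
rewrite /jac gl.1 -surjective_pairing -[inl (s e.1)]/(vmap s (inl e.1))
  !velocity_st.
by rewrite /dhyp_angle /dhyp_im /dhyp_re /= !subrr !(mulr0, mul0r, addr0,
  oppr0).
Qed.

Let edge_sum (x : edge a + edge b) : edge n :=
  match x with inl e => se e | inr e => te e end.

Let edge_sum_bij : bijective edge_sum.
Proof.
exists (fun e => match r e.1 with inl k => inl (k, e.2) | inr k => inr (k,
  e.2) end).
  by move=> [[k i]|[k i]] /=; [rewrite (rK (inl k))|rewrite (rK (inr k))].
move=> [m i] /=; case: (st_cover m) => -[k ->].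
  by rewrite (rK (inl k)).
by rewrite (rK (inr k)).
Qed.

Lemma fdet_jac_join z : fdet (jac G (J z)) =
  fdet (jac G1 z.1) * fdet (jac G2 z.2).
Proof.
rewrite (fdet_block edge_sum_bij); last by move=> x y; exact: jac_join0.
congr (_ * _); congr (\det _); apply/matrixP => i j; rewrite !mxE.
  exact: jac_joinl.
exact: jac_joinr.
Qed.

Lemma conf_dom_join z : (forall k l, tnth z.2 l <> tnth z.1 k) ->
  conf_dom (J z) <-> conf_dom z.1 /\ conf_dom z.2.
Proof.
move=> coll; split.
  move=> /conf_domP[h d]; split; apply/conf_domP; split.
  - by move=> k; have := h (s k); rewrite (joinl rK).
  - move=> k l kl; have := d (s k) (s l); rewrite !(joinl rK); apply.
    by rewrite (inj_eq s_inj).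
  - by move=> k; have := h (t k); rewrite (joinr rK).
  - move=> k l kl; have := d (t k) (t l); rewrite !(joinr rK); apply.
    by rewrite (inj_eq t_inj).
move=> [/conf_domP[h1 d1] /conf_domP[h2 d2]]; apply/conf_domP; split.
  by move=> m; case: (st_cover m) => -[k ->]; rewrite ?(joinl rK) ?(joinr rK).
move=> m m'; case: (st_cover m) => -[k ->]; case: (st_cover m') => -[l ->];
  rewrite ?(joinl rK) ?(joinr rK).
- by rewrite (inj_eq s_inj); exact: d1.
- by move=> _ /esym; exact: coll.
- by move=> _; exact: coll.
- by rewrite (inj_eq t_inj); exact: d2.
Qed.

(** Extension by 0 turns integrals over the domain into integrals over the full space, where
    [Rintegral_prod] and [Rintegral_join] apply. *)
Let F n (G : kgraph n) : config n ->
  R := (fun z => fdet (jac G z)) \_ (@conf_dom R n).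

Let measurable_F m (H : kgraph m) : measurable_fun setT (F H).
Proof.
apply/(measurable_restrictT _ (@measurable_conf_dom R m)).
by apply: measurable_funTS; exact: measurable_fdet_jac.
Qed.

Lemma weight_gluing : weight G = weight G1 * weight G2 :> R.
Proof.
have nab : n = (a + b)%N.
  by have := bij_eq_card (st_sum_bij st); rewrite card_sum !card_ord.
rewrite !weight_fdet.
rewrite [X in _ * X = _]Rintegral_mkcond [X in _ = _ * X * _]Rintegral_mkcond.
rewrite [X in _ = _ * (_ * X)]Rintegral_mkcond mulrACA -invfM -exprD -mulnDr
  -nab.
congr (_ * _).
rewrite -(Rintegral_prod _ _ (measurable_F G1) (measurable_F G2)).
rewrite /config_measure (Rintegral_join st rK _ (measurable_F G)).
rewrite /Rintegral; congr fine; apply: ae_eq_integral => //.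
- apply/measurable_EFinP; apply: (measurableT_comp (measurable_F G)).
  exact: measurable_join.
- apply/measurable_EFinP; apply: measurable_funM.
    by apply: (measurableT_comp (measurable_F G1)).
  by apply: (measurableT_comp (measurable_F G2)).
apply: filterS (@ae_no_collision R a b) => z coll _ /=; congr EFin.
rewrite /F !patchE; have domP := conf_dom_join coll.
have [Jz|Jz] := pselect (conf_dom (J z)).
  have [z1 z2] := domP.1 Jz; rewrite !mem_set//; exact: fdet_jac_join.
rewrite [X in if X then _ else _]memNset//.
have [z1|z1] := pselect (conf_dom z.1); last by rewrite (memNset z1) mul0r.
have [z2|z2] := pselect (conf_dom z.2); last by rewrite (memNset z2) mulr0.
by case: Jz; exact: domP.2.
Qed.

End weight_product.

(** * Exponential formula *)

Lemma lmod_mulIrn (K : numFieldType) (V : lmodType K) (u v : V) n :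
  (0 < n)%N -> u *+ n = v *+ n -> u = v.
Proof.
move=> n0 uv; have n_neq0 : (n%:R : K) != 0 by rewrite pnatr_eq0 -lt0n.
by apply: (scalerI n_neq0); rewrite !scaler_nat.
Qed.

Section exponential_series.
Context {R : numFieldType} {A : comAlgType R}.
Implicit Types (S T : nat -> A) (s : {poly A}).

(** Below [N], powers of a series are powers of its truncation, so derivatives can be taken in
    [{poly A}]. *)
Lemma coef_series_pow S N k m : (m < N)%N ->
  series_pow S k m = ((\poly_(i < N) S i) ^+ k)`_m.
Proof.
elim: k m => [|k IH] m mN; first by rewrite expr0 coef1.
rewrite exprS coefM /series_pow iterS -/(series_pow S k) /series_mul.
apply: eq_bigr => i _; rewrite coef_poly (leq_ltn_trans (leq_ord i) mN).
by rewrite IH// (leq_ltn_trans (leq_subr _ _) mN).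
Qed.

Lemma series_pow_lt S k m : S 0%N = 0 -> (m < k)%N -> series_pow S k m = 0.
Proof.
move=> S0; elim: k m => // k IH m mk.
rewrite /series_pow iterS -/(series_pow S k) /series_mul big1// => -[[|i] im]
  _ /=.
  by rewrite S0 mul0r.
by rewrite IH ?mulr0//; move: im mk; rewrite !ltnS; lia.
Qed.

Lemma series_expE S N m : S 0%N = 0 -> (m < N)%N ->
  series_exp (R := R) S m = \sum_(k < N) (k`!%:R : R)^-1 *: series_pow S k m.
Proof.
move=> S0 mN; rewrite /series_exp (big_ord_widen N (fun k => (k`!%:R : R)^-1 *:
  series_pow S k m))//.
rewrite big_mkcond; apply: eq_bigr => k _; case: ltnP => // mk.
by rewrite series_pow_lt ?scaler0.
Qed.

(* h E' = (h S') E for E = exp S. *)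
Lemma series_exp_rec S n : S 0%N = 0 ->
  series_exp (R := R) S n *+ n =
  \sum_(k < n.+1) (S k *+ k) * series_exp (R := R) S (n - k).
Proof.
move=> S0; rewrite big_ord_recl /= mulr0n mul0r add0r.
case: n => [|n]; first by rewrite big_ord0 mulr0n.
(* Coefficients up to [n.+1] occur, so truncating at [n.+2] loses nothing. *)
pose N := n.+2; pose s : {poly A} := \poly_(i < N) S i.
pose c k : A := ((k`!%:R : R)^-1)%:A.
pose e K : {poly A} := \sum_(k < K) c k *: s ^+ k.
have eE K m : (m < K)%N -> (m < N)%N -> (e K)`_m = series_exp (R := R) S m.
  move=> mK mN; rewrite (series_expE S0 mK) coef_sum; apply: eq_bigr => k _.
  by rewrite coefZ mulr_algl (coef_series_pow S k mN).
rewrite -(@eE N)// -coef_deriv.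
(* Differentiating a truncated exponential drops its last term; [e n.+1] still has the right
   coefficients up to [n]. *)
have -> : (e N)^`() = s^`() * e n.+1.
  rewrite /e raddf_sum big_ord_recl /= expr0 derivZ -[1]/(1%:P) derivC scaler0
    add0r mulr_sumr.
  apply: eq_bigr => k _;
    rewrite derivZ deriv_exp /= -scalerAr -scaler_nat scalerA.
  congr (_ *: _); rewrite /c /bump /= add1n.
  rewrite mulr_algl -(@scaler_nat R A k.+1 1) scalerA; congr (_ *: _).
  by rewrite factS natrM invfM mulrAC mulVf ?mul1r// pnatr_eq0.
rewrite coefM; apply: eq_bigr => i _; rewrite coef_deriv coef_poly.
rewrite /bump /= add1n subSS.
case: ltnP => [_|]; last by have := ltn_ord i; rewrite /N; lia.
by rewrite eE//; have := ltn_ord i; rewrite /N; lia.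
Qed.

End exponential_series.

(** * Generating series of all graphs and of connected graphs *)

Section star_exponential.
Context {R : realType} {d : nat}.
Variables (alpha : 'I_d -> 'I_d -> 'rV[R]_d -> R) (x : 'rV[R]_d).
Local Notation A := (mpoly (d + d) R).

Definition gweight n (G : kgraph n) : A := weight G *: psym alpha x G.

Definition all_sum n : A := (n`!%:R : R)^-1 *: \sum_(G : kgraph n) gweight G.
Definition conn_sum n : A :=
  (n`!%:R : R)^-1 *: \sum_(G : kgraph n | kconnected G) gweight G.

Lemma gweight_gluing n (S : {set 'I_n}) (G : kgraph n) G1 G2 :
  (forall i j, smooth (alpha i j)) ->
  is_gluing (@sub_in n S) (@sub_in n (~: S)) G G1 G2 ->
  gweight G = gweight G1 * gweight G2.
Proof.
move=> salpha gl; rewrite /gweight.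
have st := sub_in_split S; have [r rK _] := st_sum_bij st.
rewrite (weight_gluing st rK gl) (psym_gluing x salpha st gl).
by move: (weight G1) (weight G2) => w1 w2; rewrite -scalerAl -scalerAr scalerA.
Qed.

(** An empty determinant is integrated over a one-point space of mass 1; this starts the
    recursion. *)
Lemma weight_empty (G : kgraph 0) : weight G = 1 :> R.
Proof.
rewrite weight_fdet muln0 expr0 invr1 mul1r.
have detE z : fdet (jac G z) = 1 :> R.
  have e0 : #|{: 'I_0 * 'I_2}| = 0%N by rewrite card_prod card_ord.
  rewrite /fdet; move: (\matrix_(_, _) _); rewrite e0 => M.
  by rewrite det_mx00.
transitivity (\int[config_measure 0]_(z in @conf_dom R 0) (1 : R)).
  by apply: eq_Rintegral => z _; exact: detE.
have -> : @conf_dom R 0 = setT.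
  by apply/seteqP; split => // z _; apply/conf_domP; split => -[].
by rewrite Rintegral_cst// mul1r [X in fine X](_ : _ = 1%E)//; exact: diracT.
Qed.

Lemma psym_empty (G : kgraph 0) : psym alpha x G = 1.
Proof.
have no_edge (e : edge 0) : False by case: e => -[].
have inc0 I v : incoming G I v = [::].
  rewrite /incoming; case: (enum _) => // e; by case: (no_edge e).
rewrite /psym (bigD1 [ffun e => False_rect 'I_d (no_edge e)])//= big1 ?addr0.
  by rewrite /psym_term !inc0 big_ord0 scale1r /smon !big_nil mulr1.
by move=> I /eqP[]; apply/ffunP => e; case: (no_edge e).
Qed.

Lemma all_sum0 : all_sum 0 = 1.
Proof.
have k0 : is_kgraph [ffun _ : edge 0 => inr ord0 : vertex 0]
  by apply/forallP => -[].
rewrite /all_sum invr1 scale1r (bigD1 (KGraph k0))//= big1 ?addr0.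
  by rewrite /gweight weight_empty psym_empty scale1r.
by move=> G /eqP[]; apply: kgraph_eq => -[[]].
Qed.

Lemma all_sum_rec n : (forall i j, smooth (alpha i j)) ->
  all_sum n *+ n = \sum_(k < n.+1) (conn_sum k *+ k) * all_sum (n - k).
Proof.
move=> salpha.
have := sum_component (w := gweight) (n :=
  n) (fun S G G1 G2 => @gweight_gluing n S G G1 G2 salpha).
rewrite /all_sum scalerMnr => ->; rewrite scaler_sumr; apply: eq_bigr => k _.
rewrite /conn_sum mulrnAl -scalerAl -scalerAr scalerA mulrnA -scalerMnr.
congr (_ *+ _); rewrite -(scaler_nat 'C(n, k)) scalerA; congr (_ *: _).
have kn : (k <= n)%N by exact: leq_ord.
rewrite -(bin_fact kn) !natrM; field.
by rewrite !pnatr_eq0 -!lt0n !fact_gt0 bin_gt0 kn.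
Qed.

(* The number of loops and the degree of the symbol, which is the number of
   ground edges, determine the number of vertices. *)
Lemma DloopE n q : (mdeg q <= n.+1)%N ->
  Dloop alpha x (n.+1 - mdeg q)%N q =
  \sum_(G : kgraph n | (0 < n)%N && kconnected G)
    weight G / n`!%:R * mcoeff q (psym alpha x G).
Proof.
move=> qn.
(* Among all graphs with [n.+1 - mdeg q] loops, only those on [n] vertices can have [q] in their
   symbol, so these finitely many carry the sum. *)
pose P (G : kgraph n) :=
  [&& (0 < n)%N, kconnected G & loops G == (n.+1 - mdeg q)%N].
pose r := [seq existT kgraph n G | G <- enum {: kgraph n} & P G].
have inr G : (existT kgraph n G \in r) = P G.
  rewrite mem_map.
    by rewrite mem_filter mem_enum andbT.
  by move=> G1 G2 /eqP; rewrite -tag_eqE /tag_eq /= eqxx /= tagged_asE => /eqP.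
have loopsE m (G : kgraph m) : mcoeff q (psym alpha x G) != 0 ->
    loops G = m%:Z - (mdeg q)%:Z + 1.
  by move=> /mcoeff_psym_deg ->.
rewrite /Dloop (fsbigE r) /=.
- rewrite [RHS]big_mkcond big_map big_filter_cond [LHS]big_enum_cond
    [LHS]big_mkcond /=.
  apply: eq_bigr => G _; rewrite symbolE.
  have -> : (P G && (existT kgraph n G \in connected_graphs (n.+1 - mdeg q))) =
    P G.
    apply: andb_idr => /and3P[n0 cG /eqP lG]; rewrite inE; split => //.
  have [Gq|Gq] := eqVneq (mcoeff q (psym alpha x G)) 0.
    by rewrite Gq mulr0 !if_same.
  (* The loop condition is automatic here; the bound on [mdeg q] makes the natural subtraction
     exact. *)
  by rewrite /P (loopsE _ _ Gq) andbA [X in _ && X](_ : _ = true) ?andbT//;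
    apply/eqP; lia.
- rewrite map_inj_uniq; first by apply: filter_uniq; exact: enum_uniq.
  by move=> G1 G2 /eqP; rewrite -tag_eqE /tag_eq /= eqxx /= tagged_asE => /eqP.
- by move=> _ /= /mapP[G + ->];
    rewrite mem_filter => /andP[/and3P[n0 cG /eqP lG] _]; split.
- move=> [m G] /= [m0 cG lG]; rewrite symbolE.
  have [->|Gq] := eqVneq (mcoeff q (psym alpha x G)) 0; first by rewrite mulr0.
  have mn : m = n by move: lG; rewrite (loopsE _ _ Gq); lia.
  case: n / mn in P r inr qn lG * => /negP[].
  by rewrite inr /P m0 cG lG eqxx.
Qed.

(** With [j] loops and [e] ground edges, [j + e = n + 1], which [divh] shifts to [n]. As the symbol
    has degree at most [n + 1] by [ground_edges_leq], the cutoff of monomials at [n.+2] loses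
    nothing. *)
Lemma conn_sumE n : (0 < n)%N ->
  divh (scale_vars (Dloop alpha x)) n = conn_sum n.
Proof.
move=> n0; rewrite /divh /scale_vars.
transitivity (\sum_(q : bmultinom (d + d) n.+2) \sum_(G : kgraph n | kconnected
  G)
    (weight G / n`!%:R * mcoeff q (psym alpha x G)) *: mpolyX R q).
  apply: eq_bigr => q _; rewrite DloopE; last by rewrite -ltnS bmdeg.
  by rewrite n0 scaler_suml.
rewrite exchange_big /conn_sum scaler_sumr; apply: eq_bigr => G cG /=.
rewrite /gweight scalerA mulrC [psym alpha x G in RHS](mpolywE (k := n.+2));
  last first.
  rewrite msizeE; apply/bigmax_leqP_seq => q; rewrite mcoeff_msupp => qG _.
  by rewrite ltnS (mcoeff_psym_deg qG) ground_edges_leq.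
by rewrite scaler_sumr; apply: eq_bigr => q _; rewrite scalerA.
Qed.

(** The graphs in the exponent are nonempty; without a constant term, the exponential is a finite
    sum in each order. *)
Lemma divh_scale_vars0 : divh (scale_vars (Dloop alpha x)) 0%N = 0.
Proof.
rewrite /divh /scale_vars big1// => q _; rewrite DloopE ?big_pred0 ?scale0r//.
by rewrite -ltnS bmdeg.
Qed.

Lemma all_sum_exp n : (forall i j, smooth (alpha i j)) ->
  all_sum n = series_exp (R := R) (divh (scale_vars (Dloop alpha x))) n.
Proof.
move=> salpha; set S := divh _; have S0 : S 0%N = 0 := divh_scale_vars0.
elim/ltn_ind: n => n IH; have [->|n0] := posnP n.
  by rewrite all_sum0 /series_exp big_ord1 invr1 scale1r.
have : all_sum n *+ n = series_exp (R := R) S n *+ n.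
  rewrite (all_sum_rec _ salpha) series_exp_rec//;
    apply: eq_bigr => -[[|k] kn] _ /=.
    (* The empty graph is vacuously connected, so [conn_sum] at 0 is 1 and differs from the constant
       term of [S]; the factor [k] hides this. *)
    by rewrite !mulr0n !mul0r.
  by rewrite -conn_sumE// IH// ltn_subrL n0.
exact: lmod_mulIrn.
Qed.

End star_exponential.

Theorem lemma13 (R : realType) (d : nat)
    (alpha : 'I_d -> 'I_d -> 'rV[R]_d -> R) (f g : 'rV[R]_d -> R) :
  is_poisson alpha -> smooth f -> smooth g ->
  forall (x : 'rV[R]_d) (m : nat),
    star_product alpha f g x m =
    diffop (series_exp (divh (scale_vars (Dloop alpha x))) m)
           (tensor f g) (row_mx x x).
Proof.
move=> palpha sf sg x m; have salpha := poisson_smooth palpha.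
have stable : perm_pderivs_stable (tensor f g).
  by move=> s t; exact: perm_pderivs_tensor.
(* The constant term [f g] of the star product is set separately; it matches the empty graph, whose
   symbol is 1. *)
rewrite -all_sum_exp// /star_product; case: eqP => [->|_].
  have -> : all_sum alpha x 0 = smon R [::] by rewrite all_sum0 /smon big_nil.
  by rewrite diffop_smon//= /tensor row_mxKl row_mxKr.
rewrite /all_sum diffopZ diffop_sum; congr (_ * _); apply: eq_bigr => G _.
by rewrite diffopZ kop_psym.
Qed.
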